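(* Let $A_1,\dots,A_k$ be a finite collection of arithmetic progressions $A_i = a_i + d_i\mathbb{Z}$ with moduli $d_i > 1$, and suppose that $\bigcup_{i=1}^k A_i = \mathbb{Z}$. Then there exist $i \ne j$ such that $d_i \mid d_j$.
   Context: An arithmetic progression with modulus $d$ is a set of the form $a + d\mathbb{Z}$ with $a \in \mathbb{Z}$, $d \in \mathbb{N}$. *)

(* Defs.v *)
From mathcomp Require Import all_boot all_order all_algebra.
From mathcomp Require Import classical_sets.

Set Implicit Arguments.
Unset Strict Implicit.
Unset Printing Implicit Defensive.

Local Open Scope classical_set_scope.
Local Open Scope ring_scope.

Definition arith_prog (a : int) (d : nat) : set int :=
  [set a + d%:Z * m | m in [set: int]].

(* Main.v *)
(** In a minimal cover no modulus is a prime power, since such a modulus would not divide the lcm of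
    the others. The rest is the distortion method. Start from the uniform measure on Z/Q restricted
    to the complement of the progressions with {2,3,5}-smooth moduli; by incomparability these have
    total density at most 1/3. Then process the primes p >= 7 in increasing order: remove the
    progressions whose modulus has largest prime factor p and renormalise each fibre over the
    earlier coordinates by a factor of at most 4/3. Step p loses a mass of at most 4/3 times the
    second moment of the fibre densities, which is bounded by a sum of 1/lcm over pairs of moduli
    (with a factor 4/3 for each prime >= 7). Only pairwise incomparable moduli occur in this sum,
    so its {2,3,5}-part is at most 65/36, rather than the 135/4 obtained by summing over all smooth
    numbers, and this makes the total loss smaller than 2/3. The resulting sum over primes is
    evaluated up to 2^16 and estimated beyond with Chebyshev's bound. *)

From Stdlib Require Import NArith.
Require Import Defs.
From mathcomp Require Import all_boot all_order all_algebra.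
From mathcomp Require Import classical_sets.
From mathcomp Require Import ring lra zify.

Set Implicit Arguments.
Unset Strict Implicit.
Unset Printing Implicit Defensive.

Import Order.TTheory GRing.Theory Num.Theory.

Local Open Scope ring_scope.

(** * Primitive sets of smooth numbers *)

(** The obstacle is quantitative: every estimate must hold for an arbitrary divisibility antichain
    and still leave room for the primes from 7 on. What makes this possible is that antichains
    survive slicing: fixing the exponent of the largest prime leaves an antichain of numbers without
    that prime. So all sums are bounded by peeling off one prime at a time, down to numbers
    [2 ^ i * 3 ^ j], where at most one element is odd. The lcm arises because squaring a fibre
    density produces intersections of two residue classes. The factor 4/3 is [1 / (1 - 1/4)]: with
    this cap, a fibre in which the removed set has density [a] keeps the fraction
    [(1 - a) / (1 - min a (1/4))], which is at least [1 - 4/3 * a ^ 2], so the loss is quadratic in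
    [a]. Dividing the budget 2/3 by [4/3 * 65/36 = 65/27] leaves 18/65 for the sum over primes. *)

Definition below (k : nat) : nat_pred := [pred p | p < k]%N.

Definition primitive (S : seq nat) :=
  uniq S /\ {in S &, forall x y, (x %| y)%N -> x = y}.

Definition slice (q e : nat) (S : seq nat) : seq nat :=
  [seq (x %/ q ^ e)%N | x <- S & logn q x == e].

Lemma primitive_filter (P : pred nat) S : primitive S -> primitive (filter P S).
Proof.
move=> [uS aS]; split; first exact: filter_uniq.
by move=> x y; rewrite !mem_filter => /andP[_ xS] /andP[_ yS]; apply: aS.
Qed.

Lemma sliceP q e S y : reflect (exists2 x, x \in S & logn q x = e /\ x = (q ^ e * y)%N)
  (y \in slice q e S).
Proof.
apply: (iffP mapP) => [[x]|[x xS [lx xE]]].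
  rewrite mem_filter => /andP[/eqP le xS] ->; exists x => //; split=> //.
  by rewrite mulnC divnK // -le pfactor_dvdnn.
have [q0|q0] := posnP (q ^ e); last first.
  by exists x; rewrite ?mem_filter ?lx ?eqxx // xE mulKn.
by move/eqP: q0 lx; rewrite expn_eq0 => /andP[/eqP -> e0]; rewrite lognE /= => e1; rewrite -e1 in e0.
Qed.

(** Elements with the same exponent of [q] compare under divisibility exactly as their cofactors
    do. *)
Lemma primitive_slice q e S : primitive S -> primitive (slice q e S).
Proof.
move=> [uS aS]; have D x : x \in filter (fun x => logn q x == e) S -> x = (q ^ e * (x %/ q ^ e))%N.
  by rewrite mem_filter => /andP[/eqP <- _]; rewrite mulnC divnK // pfactor_dvdnn.
split.
  rewrite map_inj_in_uniq ?filter_uniq // => x y xS yS xy.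
  by rewrite (D x) // (D y) // xy.
move=> x y /mapP[x' x'S ->] /mapP[y' y'S ->] dxy; congr (_ %/ _)%N; apply: aS.
- by move: x'S; rewrite mem_filter => /andP[].
- by move: y'S; rewrite mem_filter => /andP[].
by rewrite (D x') // (D y') // dvdn_mul.
Qed.

Section Sums.
Variable R : realFieldType.

Lemma slice_sum q K (S : seq nat) (F : nat -> R) : {in S, forall x, (logn q x < K)%N} ->
  \sum_(x <- S) F x = \sum_(e < K) \sum_(y <- slice q e S) F (q ^ e * y)%N.
Proof.
case: K => [|K] hK.
  case: S hK => [|x S] hK; first by rewrite big_nil big_ord0.
  by have := hK x (mem_head _ _).
rewrite (partition_big (fun x => inord (logn q x) : 'I_K.+1) predT) //=.
apply: eq_bigr => e _; rewrite big_map big_filter.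
rewrite big_seq_cond [RHS]big_seq_cond; apply: congr_big => // x.
  case xS: (x \in S) => //=.
  by rewrite -val_eqE /= inordK ?hK.
by case/andP=> xS /eqP <-; rewrite inordK ?hK // mulnC divnK // pfactor_dvdnn.
Qed.

Definition inv_lcm (x y : nat) : R := (lcmn x y)%:R^-1.
Definition lcm_sum (S T : seq nat) : R := \sum_(x <- S) \sum_(y <- T) inv_lcm x y.

Definition half (S : seq nat) : seq nat := [seq x./2 | x <- S & ~~ odd x].

Lemma halfP S y : (y \in half S) = (y.*2 \in S).
Proof.
apply/mapP/idP => [[x]|yS].
  by rewrite mem_filter => /andP[ox xS] ->; rewrite even_halfK.
by exists y.*2; rewrite ?doubleK // mem_filter odd_double yS.
Qed.

Lemma primitive_half S : primitive S -> primitive (half S).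
Proof.
move=> [uS aS]; split.
  rewrite map_inj_in_uniq ?filter_uniq // => x y.
  rewrite !mem_filter => /andP[ox _] /andP[oy _] xy.
  by rewrite -(even_halfK ox) -(even_halfK oy) xy.
move=> x y; rewrite !halfP => xS yS xy.
by apply: double_inj; apply: aS; rewrite // -!muln2 dvdn_pmul2r.
Qed.

Lemma half_sum (S : seq nat) (F : nat -> R) :
  \sum_(x <- S) F x = \sum_(x <- filter odd S) F x + \sum_(y <- half S) F y.*2.
Proof.
rewrite (bigID odd) /= -big_filter; congr (_ + _).
rewrite big_map big_filter; apply: eq_bigr => x ox; by rewrite even_halfK.
Qed.

End Sums.

(** The bound is strict: [smooth 5] allows the primes 2 and 3, and [smooth 7] adds 5. *)
Definition smooth (k : nat) (S : seq nat) := {in S, forall x, (below k).-nat x}.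

Lemma below_gt0 k x : (below k).-nat x -> (0 < x)%N.
Proof. by case/andP. Qed.

Lemma below_lt k x p : (below k).-nat x -> prime p -> (p %| x)%N -> (p < k)%N.
Proof.
move=> xk pp px; have := pnatPpi xk; move/(_ p); rewrite /= mem_primes pp px (below_gt0 xk).
by move=> /(_ isT).
Qed.

Lemma belowI k x : (0 < x)%N -> (forall p, prime p -> (p %| x)%N -> (p < k)%N) -> (below k).-nat x.
Proof. by move=> x0 h; apply/pnatP => // p pp px; apply: h. Qed.

Lemma prime_power_eq q x : (0 < x)%N -> (forall p, prime p -> (p %| x)%N -> p = q) ->
  x = (q ^ logn q x)%N.
Proof.
move=> x0 h; rewrite -p_part part_pnat_id //; apply/pnatP => // p pp px.
by rewrite inE /= (h p pp px).
Qed.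

Lemma prime_lt5 p : prime p -> (p < 5)%N -> p = 2%N \/ p = 3%N.
Proof. by case: p => [|[|[|[|[|]]]]] //; [left | right]. Qed.

Lemma prime_lt7 p : prime p -> (p < 7)%N -> [\/ p = 2%N, p = 3%N | p = 5%N].
Proof.
by case: p => [|[|[|[|[|[|[|]]]]]]] //; [constructor 1|constructor 2|constructor 3].
Qed.

(** Powers of one base form a chain, so an antichain contains at most one of them. *)
Lemma primitive_powers q S : primitive S -> {in S, forall x, exists b, x = (q ^ b)%N} ->
  S = [::] \/ exists b, S = [:: (q ^ b)%N].
Proof.
case: S => [|x [|y S]] [uS aS] h; first by left.
  by right; have [b ->] := h x (mem_head _ _); exists b.
have yS : y \in [:: x, y & S] by rewrite !inE eqxx orbT.
have xS : x \in [:: x, y & S] by rewrite mem_head.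
have [[b xb] [c yc]] := (h x xS, h y yS).
suff xy : x = y by move: uS; rewrite xy /= inE eqxx.
case/orP: (leq_total b c) => bc; first by apply: aS; rewrite // xb yc dvdn_exp2l.
by apply/esym/aS; rewrite // xb yc dvdn_exp2l.
Qed.

Lemma smooth_half k S : smooth k S -> smooth k (half S).
Proof.
move=> h y; rewrite halfP => /h; rewrite -muln2 => /pnat_dvd; apply.
exact: dvdn_mulr.
Qed.

Lemma below5_odd x : (below 5).-nat x -> odd x -> x = (3 ^ logn 3 x)%N.
Proof.
move=> x5 ox; apply: prime_power_eq => [|p pp px]; first exact: below_gt0 x5.
case: (prime_lt5 pp (below_lt x5 pp px)) => // p2.
by move: px; rewrite p2 dvdn2 ox.
Qed.

(** Odd elements are powers of 3, so there is at most one. If it is [3 ^ b], no other element is a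
    multiple of it, which caps the exponent of 3 in all even elements. *)
Lemma odd_part S : primitive S -> smooth 5 S ->
  filter odd S = [::] \/ exists2 b, filter odd S = [:: (3 ^ b)%N] &
     {in half S, forall y, (logn 3 y < b)%N}.
Proof.
move=> pS sS; have := @primitive_powers 3 (filter odd S) (primitive_filter _ pS).
case=> [x|->|[b bE]]; [|by left|].
  by rewrite mem_filter => /andP[ox xS]; exists (logn 3 x); apply: below5_odd; rewrite ?sS.
right; exists b => // y yS; rewrite ltnNge; apply/negP => by_.
have y0 : (0 < y)%N by apply: below_gt0 (smooth_half sS yS).
have b3 : (3 ^ b)%N \in S.
  have : (3 ^ b)%N \in filter odd S by rewrite bE mem_head.
  by rewrite mem_filter => /andP[].
rewrite halfP in yS; have := pS.2 _ _ b3 yS.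
rewrite -muln2 dvdn_mulr ?pfactor_dvdn // => /(_ isT) e.
have : odd (3 ^ b)%N by rewrite oddX orbT.
by rewrite e muln2 odd_double.
Qed.

(** Discarding the odd element and halving the others lowers the maximum, so this recursion ends at
    the empty set. *)
Lemma half_ind (P : seq nat -> Prop) : P [::] ->
  (forall S, primitive S -> smooth 5 S -> P (half S) -> P S) ->
  forall S, primitive S -> smooth 5 S -> P S.
Proof.
move=> P0 PS S pS sS; have [n] : exists n, {in S, forall x, (x <= n)%N}.
  by exists (\sum_(x <- S) x)%N => x xS; rewrite (big_rem x) //= leq_addr.
elim: n S pS sS => [|n IH] S pS sS hn.
  case: S pS sS hn => // x S pS sS hn.
  by have := below_gt0 (sS x (mem_head _ _)); have := hn x (mem_head _ _); lia.
apply: PS => //; apply: IH.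
- exact: primitive_half.
- exact: smooth_half.
move=> y yS; have y0 := below_gt0 (smooth_half sS yS).
by move: yS; rewrite halfP => /hn; lia.
Qed.

(** * Reciprocal sums over antichains of numbers [2 ^ i * 3 ^ j] *)

Section TwoThree.
Variable R : realFieldType.
Local Notation inv_lcm := (@inv_lcm R).
Local Notation lcm_sum := (@lcm_sum R).

Definition inv_sum (S : seq nat) : R := \sum_(x <- S) x%:R^-1.

Lemma two_div_exp2_le2 b : 2 / 2 ^+ b <= 2 :> R.
Proof.
have h : 1 <= 2 ^+ b :> R by apply: exprn_ege1; lra.
by rewrite ler_pdivrMr ?exprn_gt0 // ler_peMr //; lra.
Qed.

(** In such an antichain the exponents of 3 are distinct, and so are those of 2. Hence there are at
    most [b] elements, and the bound is the geometric sum of [b] terms starting at 1. *)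
Lemma sum_two_adic b S : primitive S -> smooth 5 S -> {in S, forall x, (logn 3 x < b)%N} ->
  \sum_(x <- S) (2 ^+ logn 2 x)^-1 <= 2 - 2 / 2 ^+ b :> R.
Proof.
move=> pS sS; move: S pS sS b; apply: half_ind => [b _|S pS sS IH b hb].
  by rewrite big_nil subr_ge0 two_div_exp2_le2.
have -> : \sum_(x <- S) (2 ^+ logn 2 x)^-1 = \sum_(x <- filter odd S) (2 ^+ logn 2 x)^-1
    + 2^-1 * \sum_(x <- half S) (2 ^+ logn 2 x)^-1 :> R.
  rewrite half_sum; congr (_ + _); rewrite mulr_sumr big_seq [RHS]big_seq.
  apply: eq_bigr => y yS; have y0 := below_gt0 (smooth_half sS yS).
  by rewrite -mul2n lognM // exprD expr1 invfM.
have hb' c : {in half S, forall x, (logn 3 x < c)%N} ->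
   \sum_(x <- half S) (2 ^+ logn 2 x)^-1 <= 2 - 2 / 2 ^+ c :> R by apply: IH.
case: (odd_part pS sS) => [->|[c cE hc]].
  rewrite big_nil add0r.
  have {}hb' := hb' b _.
  have : \sum_(x <- half S) (2 ^+ logn 2 x)^-1 <= 2 - 2 / 2 ^+ b :> R.
    apply: hb' => y; rewrite halfP => yS; have := hb _ yS.
    have := below_gt0 (sS _ yS); rewrite double_gt0 => y0.
    by rewrite -mul2n lognM.
  have := two_div_exp2_le2 b.
  by lra.
have cb : (c < b)%N.
  have : (3 ^ c)%N \in filter odd S by rewrite cE mem_head.
  by rewrite mem_filter => /andP[_ /hb]; rewrite pfactorK.
rewrite cE big_seq1 lognX /= (_ : logn 2 3 = 0)%N // muln0 expr0 invr1.
have := hb' _ hc.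
have -> : 2 / 2 ^+ c = 2 * (2 / 2 ^+ c.+1) :> R.
  rewrite exprS invfM; set z := (2 ^+ c)^-1; lra.
have : 2 / 2 ^+ b <= 2 / 2 ^+ c.+1 :> R.
  by rewrite ler_pM2l // lef_pV2 ?posrE ?exprn_gt0 // ler_eXn2l //; lra.
by lra.
Qed.

Lemma inv_sum_half S : inv_sum S = inv_sum (filter odd S) + inv_sum (half S) / 2.
Proof.
rewrite /inv_sum half_sum; congr (_ + _); rewrite mulr_suml; apply: eq_bigr => y _.
by rewrite -muln2 natrM invfM.
Qed.

Lemma inv3_le b c : (c <= b)%N -> (3 ^ b)%:R^-1 <= (3 ^ c)%:R^-1 :> R.
Proof. by move=> cb; rewrite lef_pV2 ?posrE ?ltr0n ?expn_gt0 // ler_nat leq_exp2l. Qed.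

Lemma inv_sum_le1 S : primitive S -> smooth 5 S -> inv_sum S <= 1.
Proof.
move: S; apply: half_ind => [|S pS sS IH]; first by rewrite /inv_sum big_nil.
rewrite inv_sum_half; case: (odd_part pS sS) => [->|[[|b] bE hb]].
- by rewrite {1}/inv_sum big_nil; lra.
- have -> : half S = [::].
    by case: (half S) hb => // y s /(_ y (mem_head _ _)).
  by rewrite bE /inv_sum big_nil big_seq1 expn0 invr1; lra.
rewrite bE {1}/inv_sum big_seq1.
have := @inv3_le b.+1 1 isT; lra.
Qed.

(** The extremal set is {2, 3}. *)
Lemma inv_sum_le56 S : primitive S -> smooth 5 S -> 1%N \notin S -> inv_sum S <= 5 / 6.
Proof.
move=> pS sS S1; rewrite inv_sum_half.
have := inv_sum_le1 (primitive_half pS) (smooth_half sS).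
case: (odd_part pS sS) => [->|[[|b] bE hb]].
- by rewrite {2}/inv_sum big_nil; lra.
- case/negP: S1; have : 1%N \in filter odd S by rewrite bE mem_head.
  by rewrite mem_filter.
rewrite bE {2}/inv_sum big_seq1.
have := @inv3_le b.+1 1 isT; lra.
Qed.

Lemma half_pow2 S : primitive S -> smooth 5 S ->
  {in half S, forall y, (logn 3 y < 1)%N} ->
  half S = [::] \/ exists j, half S = [:: (2 ^ j)%N].
Proof.
move=> pS sS h; apply: primitive_powers (primitive_half pS) _ => y yS.
have y5 := smooth_half sS yS; exists (logn 2 y); apply: prime_power_eq (below_gt0 y5) _.
move=> p pp py; case: (prime_lt5 pp (below_lt y5 pp py)) => // p3.
have := h _ yS; rewrite ltnS leqn0 => /eqP l0.
by have := @pfactor_dvdn 3 1 y isT (below_gt0 y5); rewrite l0 -p3 expn1 py.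
Qed.

Lemma inv2_le b c : (c <= b)%N -> (2 ^ b)%:R^-1 <= (2 ^ c)%:R^-1 :> R.
Proof. by move=> cb; rewrite lef_pV2 ?posrE ?ltr0n ?expn_gt0 // ler_nat leq_exp2l. Qed.

(** Now {2, 9} is extremal, with [1/2 + 1/9]; sets containing 3 but not 2 reach at most
    [1/3 + 1/4]. *)
Lemma inv_sum_le1118 S : primitive S -> smooth 5 S -> 1%N \notin S ->
  ~~ ((2%N \in S) && (3%N \in S)) -> inv_sum S <= 11 / 18.
Proof.
move=> pS sS S1 S23; rewrite inv_sum_half.
have h1 := inv_sum_le1 (primitive_half pS) (smooth_half sS).
case: (odd_part pS sS) => [->|[[|[|b]] bE hb]].
- by rewrite {1}/inv_sum big_nil; lra.
- case/negP: S1; have : 1%N \in filter odd S by rewrite bE mem_head.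
  by rewrite mem_filter.
- have S3 : 3%N \in S.
    have : 3%N \in filter odd S by rewrite bE mem_head.
    by rewrite mem_filter => /andP[].
  rewrite bE {1}/inv_sum big_seq1 expn1; case: (half_pow2 pS sS hb) => [->|[j jE]].
    by rewrite /inv_sum big_nil; lra.
  case: j jE => [|j] jE.
    by case/negP: S23; rewrite S3 andbT -[2%N]/(1.*2) -halfP jE mem_head.
  rewrite jE /inv_sum big_seq1.
  have := @inv2_le j.+1 1 isT; lra.
rewrite bE {1}/inv_sum big_seq1.
have := @inv3_le b.+2 2 isT; rewrite (_ : 3 ^ 2 = 9)%N //; lra.
Qed.

End TwoThree.

Lemma primitive_div m S : (0 < m)%N -> primitive S -> {in S, forall x, (m %| x)%N} ->
  primitive [seq (x %/ m)%N | x <- S].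
Proof.
move=> m0 [uS aS] hm; split.
  rewrite map_inj_in_uniq // => x y xS yS /= e.
  by rewrite -(divnK (hm x xS)) e divnK ?hm.
move=> _ _ /mapP[x xS ->] /mapP[y yS ->] d; congr (_ %/ _)%N; apply: aS => //.
by rewrite -(divnK (hm x xS)) -(divnK (hm y yS)) dvdn_pmul2r.
Qed.

Lemma smooth_div k m S : smooth k S -> {in S, forall x, (m %| x)%N} ->
  smooth k [seq (x %/ m)%N | x <- S].
Proof.
move=> sS hm _ /mapP[x xS ->]; apply: pnat_dvd (sS x xS).
by rewrite -{2}(divnK (hm x xS)) dvdn_mulr.
Qed.

Lemma below5_eq y : (below 5).-nat y -> y = (2 ^ logn 2 y * 3 ^ logn 3 y)%N.
Proof.
move=> y5; have y0 := below_gt0 y5.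
have o : odd (y`_2^')%N by rewrite odd_2'nat part_pnat.
rewrite -[LHS](partnC 2%N y0) p_part; congr (_ * _)%N.
rewrite {1}(below5_odd _ o) ?logn_part //.
  by rewrite -{2}(partnC 2%N y0) lognM ?part_gt0 // p_part lognX muln0.
by apply: pnat_dvd y5; apply: dvdn_part.
Qed.

(** * Sums of 1 / lcm over antichains of numbers [2 ^ i * 3 ^ j] *)

Section TwoThreePairs.
Variable R : realFieldType.
Local Notation inv_lcm := (@inv_lcm R).
Local Notation lcm_sum := (@lcm_sum R).
Local Notation inv_sum := (@inv_sum R).

Lemma inv_sum_six S : primitive S -> smooth 5 S -> {in S, forall x, (6 %| x)%N} -> inv_sum S <= 1 / 6.
Proof.
move=> pS sS h6; have := inv_sum_le1 R (primitive_div (isT : 0 < 6)%N pS h6) (smooth_div sS h6).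
have -> : inv_sum [seq (x %/ 6)%N | x <- S] = 6 * inv_sum S.
  rewrite /inv_sum big_map mulr_sumr big_seq [RHS]big_seq; apply: eq_bigr => x xS.
  by rewrite -{2}(divnK (h6 x xS)) natrM invfM mulrCA mulfV ?mulr1 // pnatr_eq0.
by lra.
Qed.

Lemma inv_lcmC x y : inv_lcm x y = inv_lcm y x.
Proof. by rewrite /inv_lcm lcmnC. Qed.

Lemma inv_lcmxx x : inv_lcm x x = x%:R^-1.
Proof. by rewrite /inv_lcm /lcmn gcdnn; case: x => // x; rewrite mulnK. Qed.

Lemma lcm_sum_half S : lcm_sum S S = lcm_sum (filter odd S) (filter odd S) +
  2 * (\sum_(x <- filter odd S) \sum_(y <- half S) inv_lcm x y.*2) + lcm_sum (half S) (half S) / 2.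
Proof.
rewrite {1}/lcm_sum half_sum.
under eq_bigr => x _ do rewrite half_sum.
under [X in _ + X]eq_bigr => x _ do rewrite half_sum.
rewrite !big_split /= -/(lcm_sum _ _).
have -> : \sum_(i <- half S) \sum_(x <- filter odd S) inv_lcm i.*2 x =
   \sum_(x <- filter odd S) \sum_(y <- half S) inv_lcm x y.*2.
  by rewrite exchange_big; apply: eq_bigr => x _; apply: eq_bigr => y _; exact: inv_lcmC.
have -> : \sum_(i <- half S) \sum_(y <- half S) inv_lcm i.*2 y.*2 = lcm_sum (half S) (half S) / 2.
  rewrite /lcm_sum mulr_suml; apply: eq_bigr => x _; rewrite mulr_suml; apply: eq_bigr => y _.
  by rewrite /inv_lcm -!muln2 -muln_lcml natrM invfM.
by ring.
Qed.

(** The lcm takes its power of 3 from [3 ^ b] and its power of 2 from [y.*2]. The cross terms of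
    [lcm_sum_half] thus reduce to the sum bounded by [sum_two_adic]. *)
Lemma inv_lcm_pow3_double b y : (below 5).-nat y -> (logn 3 y < b)%N ->
  inv_lcm (3 ^ b) y.*2 = (3 ^ b)%:R^-1 * ((2 ^+ logn 2 y)^-1 / 2).
Proof.
move=> y5 yb; have y0 := below_gt0 y5.
have yE := below5_eq y5.
set i := logn 2 y in yE *; set j := logn 3 y in yE yb *.
have := muln_lcm_gcd (3 ^ b) y.*2.
have -> : gcdn (3 ^ b) y.*2 = (3 ^ j)%N.
  rewrite yE -muln2 -mulnA mulnCA -(subnK (ltnW yb)) expnD mulnC -muln_gcdr.
  rewrite (_ : gcdn _ _ = 1)%N ?muln1 //; apply/eqP.
  by rewrite -[_ == _]/(coprime _ _) coprimeXl // -expnSr coprimeXr.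
move=> e; have {}e : (lcmn (3 ^ b) y.*2)%:R * (3 ^ j)%:R = (3 ^ b)%:R * (2 ^ i * 3 ^ j * 2)%:R :> R.
  by rewrite -!natrM e {1}yE muln2.
have e3 k : (3 ^ k)%:R != 0 :> R by rewrite pnatr_eq0 expn_eq0.
have e2 : 2 ^+ i != 0 :> R by rewrite expf_neq0 ?pnatr_eq0.
rewrite /inv_lcm.
have -> : (lcmn (3 ^ b) y.*2)%:R = (3 ^ b)%:R * (2 ^+ i * 2) :> R.
  apply: (mulIf (e3 j)); rewrite e !natrM -natrX; ring.
by rewrite !invfM; ring.
Qed.

Lemma lcm_sum_pow2 S j : half S = [:: (2 ^ j)%N] -> lcm_sum (half S) (half S) = (2 ^ j)%:R^-1.
Proof. by move=> ->; rewrite /lcm_sum !big_seq1 inv_lcmxx. Qed.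

Lemma lcm_sum_odd1 S b : primitive S -> smooth 5 S -> filter odd S = [:: (3 ^ b)%N] ->
  {in half S, forall y, (logn 3 y < b)%N} ->
  lcm_sum S S = (3 ^ b)%:R^-1 * (1 + \sum_(y <- half S) (2 ^+ logn 2 y)^-1) + lcm_sum (half S) (half S) / 2.
Proof.
move=> pS sS bE hb; rewrite lcm_sum_half bE; congr (_ + _).
rewrite {1}/lcm_sum !big_seq1 inv_lcmxx mulrDr mulr1; congr (_ + _).
rewrite !mulr_sumr big_seq [RHS]big_seq; apply: eq_bigr => y yS.
rewrite inv_lcm_pow3_double ?hb //; last exact: smooth_half yS.
by field; rewrite pnatr_eq0 expn_eq0 /= expf_neq0 ?pnatr_eq0.
Qed.

Lemma lcm_sum_odd0 S : filter odd S = [::] -> lcm_sum S S = lcm_sum (half S) (half S) / 2.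
Proof. by move=> e; rewrite lcm_sum_half e /lcm_sum !big_nil; ring. Qed.

(** For [3 ^ 2] the 2-adic sum is at most 3/2, giving [1/9 * 5/2]; from [3 ^ 3] on, its crude bound
    2 suffices. *)
Lemma pow3_adic_le b S : primitive S -> smooth 5 S -> {in half S, forall y, (logn 3 y < b.+2)%N} ->
  (3 ^ b.+2)%:R^-1 * (1 + \sum_(y <- half S) (2 ^+ logn 2 y)^-1) <= 5 / 18 :> R.
Proof.
move=> pS sS hb; have := sum_two_adic R (primitive_half pS) (smooth_half sS) hb.
set G := \sum_(_ <- _) _; case: b hb => [|b] _ hG.
  by rewrite (_ : 3 ^ 2 = 9)%N // ; rewrite expr2 in hG; lra.
have := inv3_le R (isT : 3 <= b.+3)%N; rewrite (_ : 3 ^ 3 = 27)%N // => h3.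
have G3 : 1 + G <= 3.
  have : 0 <= 2 / 2 ^+ b.+3 :> R by rewrite divr_ge0 ?exprn_ge0; lra.
  lra.
have G0 : 0 <= 1 + G.
  by rewrite addr_ge0 // ?sumr_ge0 // => y _; rewrite invr_ge0 exprn_ge0; lra.
apply: le_trans (ler_wpM2r G0 h3) _; lra.
Qed.

Lemma one_of_odd S : filter odd S = [:: (3 ^ 0)%N] -> 1%N \in S.
Proof.
move=> e; have : 1%N \in filter odd S by rewrite e mem_head.
by rewrite mem_filter => /andP[].
Qed.

(** The extremal set is {2, 3}, with [1/2 + 1/3 + 2/6]. *)
Lemma lcm_sum_le76 S : primitive S -> smooth 5 S -> lcm_sum S S <= 7 / 6.
Proof.
move: S; apply: half_ind => [|S pS sS IH]; first by rewrite /lcm_sum big_nil; lra.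
case: (odd_part pS sS) => [/lcm_sum_odd0 -> |[[|[|b]] bE hb]]; first by lra.
- rewrite (lcm_sum_odd1 pS sS bE hb).
  have -> : half S = [::].
    by case: (half S) hb => // y s /(_ y (mem_head _ _)).
  by rewrite /lcm_sum !big_nil expn0 invr1; lra.
- rewrite (lcm_sum_odd1 pS sS bE hb); case: (half_pow2 pS sS hb) => [->|[j jE]].
    by rewrite /lcm_sum !big_nil expn1; lra.
  rewrite (lcm_sum_pow2 jE) jE big_seq1 pfactorK // -natrX expn1.
  have := inv2_le R (leq0n j); lra.
rewrite (lcm_sum_odd1 pS sS bE hb).
have := pow3_adic_le pS sS hb; lra.
Qed.

(** The constant is [5/18 + 7/12]: the odd element is at least 9, and the halved set obeys the bound
    7/6. *)
Lemma lcm_sum_le3136 S : primitive S -> smooth 5 S -> 1%N \notin S ->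
  ~~ ((2%N \in S) && (3%N \in S)) -> lcm_sum S S <= 31 / 36.
Proof.
move=> pS sS S1 S23; have IH := lcm_sum_le76 (primitive_half pS) (smooth_half sS).
case: (odd_part pS sS) => [/lcm_sum_odd0 -> |[[|[|b]] bE hb]]; first by lra.
- by rewrite one_of_odd in S1.
- have S3 : 3%N \in S.
    have : 3%N \in filter odd S by rewrite bE mem_head.
    by rewrite mem_filter => /andP[].
  rewrite (lcm_sum_odd1 pS sS bE hb); case: (half_pow2 pS sS hb) => [->|[j jE]].
    by rewrite /lcm_sum !big_nil expn1; lra.
  rewrite (lcm_sum_pow2 jE) jE big_seq1 pfactorK // -natrX expn1.
  case: j jE => [|j] jE.
    by case/negP: S23; rewrite S3 andbT -[2%N]/(1.*2) -halfP jE mem_head.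
  have := inv2_le R (isT : 1 <= j.+1)%N; lra.
rewrite (lcm_sum_odd1 pS sS bE hb).
have := pow3_adic_le pS sS hb; lra.
Qed.

End TwoThreePairs.

Lemma primitive_one S : primitive S -> 1%N \in S -> S = [:: 1%N].
Proof.
case: S => [|x [|y S]] [uS aS] S1 //.
  by move: S1; rewrite inE => /eqP <-.
have h z : z \in [:: x, y & S] -> z = 1%N by move=> zS; rewrite (aS _ _ S1 zS) ?dvd1n.
have xy : x = y by rewrite (h x) ?mem_head // (h y) // !inE eqxx orbT.
by move: uS; rewrite xy /= inE eqxx.
Qed.

Lemma below_nonprime k x : ~~ prime k -> (below k.+1).-nat x -> (below k).-nat x.
Proof.
move=> nk xk; apply: belowI => [|p pp px]; first exact: below_gt0 xk.
have := below_lt xk pp px; rewrite ltnS leq_eqVlt => /orP[/eqP pk|//].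
by rewrite -pk pp in nk.
Qed.

Lemma slice_ndvd q e S y : prime q -> smooth q.+1 S -> y \in slice q e S ->
  (0 < y)%N /\ ~~ (q %| y)%N.
Proof.
move=> pq sS /sliceP[x xS [lx xE]]; have x0 := below_gt0 (sS x xS).
have y0 : (0 < y)%N by move: x0; rewrite xE muln_gt0 => /andP[].
split=> //; apply/negP => qy; move: lx; rewrite xE lognM //; last by rewrite expn_gt0 prime_gt0.
rewrite lognX logn_prime // eqxx muln1.
by have := qy; rewrite -[q in (q %| _)%N]expn1 pfactor_dvdn //; lia.
Qed.

Lemma smooth_slice q e S : prime q -> smooth q.+1 S -> smooth q (slice q e S).
Proof.
move=> pq sS y yS; have [y0 qy] := slice_ndvd pq sS yS.
case/sliceP: yS => x xS [lx xE]; apply: belowI => // p pp py.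
have := below_lt (sS x xS) pp; rewrite {1}xE dvdn_mull // => /(_ isT).
rewrite ltnS leq_eqVlt => /orP[/eqP pq'|//].
by rewrite -pq' py in qy.
Qed.

Lemma lcm_pow_mul q e f y z : prime q -> ~~ (q %| y)%N -> ~~ (q %| z)%N ->
  lcmn (q ^ e * y) (q ^ f * z) = (q ^ maxn e f * lcmn y z)%N.
Proof.
move=> pq; wlog ef : e f y z / (e <= f)%N => [hw|] qy qz.
  case/orP: (leq_total e f) => ef; first exact: hw.
  by rewrite lcmnC maxnC hw // (lcmnC y).
rewrite (maxn_idPr ef) -{1}(subnKC ef) expnD -mulnA -muln_lcmr.
rewrite -{2}(subnKC ef) expnD -mulnA; congr (_ * _)%N.
rewrite /lcmn [gcdn y (_ * _)]Gauss_gcdr; last by rewrite coprimeXr // coprime_sym prime_coprime.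
by rewrite mulnCA muln_divA // dvdn_mulr // dvdn_gcdl.
Qed.

(** * Sums over pairs of slices *)

Section Nu.
Variable R : realFieldType.
Local Notation inv_lcm := (@inv_lcm R).
Local Notation lcm_sum := (@lcm_sum R).
Local Notation inv_sum := (@inv_sum R).

(* [nu m] bounds the measure of a residue class mod m after all the distortion steps: a prime
   q >= 7 dividing m costs the factor 4/3, and the primes 2, 3, 5 are never distorted. *)
Definition cost (q : nat) : R := if (7 <= q)%N then 4 / 3 else 1.
Definition nu (m : nat) : R := (\prod_(q <- primes m) cost q) / m%:R.
Definition nu_sum (S T : seq nat) : R := \sum_(x <- S) \sum_(y <- T) nu (lcmn x y).
Definition slice_weight (q j : nat) : R := if j == 0%N then 1 else cost q / (q ^ j)%:R.

Lemma cost_ge1 q : 1 <= cost q.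
Proof. by rewrite /cost; case: ifP => _; lra. Qed.

Lemma nu_mul_pow q j m : prime q -> (0 < m)%N -> ~~ (q %| m)%N -> nu (q ^ j * m) = slice_weight q j * nu m.
Proof.
move=> pq m0 qm; rewrite /slice_weight; case: eqP => [->|/eqP j0]; first by rewrite expn0 mul1n mul1r.
have q0 := prime_gt0 pq; rewrite -lt0n in j0.
rewrite /nu (perm_big (q :: primes m)) /=; last first.
  apply: uniq_perm; rewrite /= ?primes_uniq ?andbT ?mem_primes ?(negPf qm) ?andbF //.
  move=> p; rewrite primesM ?expn_gt0 ?q0 // inE primesX // primes_prime // inE.
  by [].
by rewrite big_cons natrM invfM; ring.
Qed.

Lemma nu_below7 m : (below 7).-nat m -> nu m = m%:R^-1.
Proof.
move=> m7; rewrite /nu big_seq big1 ?mul1r // => q; rewrite mem_primes => /and3P[pq _ qm].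
by rewrite /cost leqNgt (below_lt m7 pq qm).
Qed.

(** The exponent of [q] in an lcm is the larger of the two exponents, so the weight of a pair of
    slices depends on [maxn e f] only. *)
Lemma nu_sum_slice q K S T : prime q -> smooth q.+1 S -> smooth q.+1 T ->
  {in S, forall x, (logn q x < K)%N} -> {in T, forall x, (logn q x < K)%N} ->
  nu_sum S T = \sum_(e < K) \sum_(f < K) slice_weight q (maxn e f) * nu_sum (slice q e S) (slice q f T).
Proof.
move=> pq sS sT hS hT; rewrite /nu_sum (slice_sum _ hS); apply: eq_bigr => e _.
under eq_bigr => y _ do rewrite (slice_sum _ hT).
rewrite exchange_big; apply: eq_bigr => f _; rewrite mulr_sumr.
rewrite big_seq [RHS]big_seq; apply: eq_bigr => y yS; rewrite mulr_sumr.
rewrite big_seq [RHS]big_seq; apply: eq_bigr => z zT.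
have [y0 qy] := slice_ndvd pq sS yS; have [z0 qz] := slice_ndvd pq sT zT.
rewrite lcm_pow_mul // nu_mul_pow ?lcmn_gt0 ?y0 //.
apply/negP => ql; have : (q %| y * z)%N.
  by apply: dvdn_trans ql _; rewrite dvdn_lcm dvdn_mulr // dvdn_mull.
by rewrite Euclid_dvdM // (negPf qy) (negPf qz).
Qed.

Lemma nu_sum_lcm_sum S T : smooth 7 S -> smooth 7 T -> nu_sum S T = lcm_sum S T.
Proof.
move=> sS sT; rewrite /nu_sum /lcm_sum big_seq [RHS]big_seq; apply: eq_bigr => x xS.
rewrite big_seq [RHS]big_seq; apply: eq_bigr => y yT; rewrite nu_below7 //.
have x7 := sS x xS; have y7 := sT y yT.
have x0 := below_gt0 x7; have y0 := below_gt0 y7.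
apply: belowI => [|p pp pl]; first by rewrite lcmn_gt0 x0.
have : (p %| x * y)%N.
  by apply: dvdn_trans pl _; rewrite dvdn_lcm dvdn_mulr // dvdn_mull.
by rewrite Euclid_dvdM // => /orP[]; apply: below_lt.
Qed.

Lemma sum_class n k c : (0 < n)%N ->
  \sum_(0 <= x < k * n) (x == c %[mod n])%:R = k%:R :> R.
Proof.
move=> n0; elim: k => [|k IH]; first by rewrite mul0n big_geq.
rewrite mulSnr (@big_cat_nat _ _ _ (k * n)) //= ?leq_addr // IH.
rewrite -{1}[(k * n)%N]add0n big_addn addKn big_mkord.
rewrite (bigD1 (Ordinal (ltn_pmod c n0))) //= big1 ?addr0 => [|i].
  by rewrite addnC modnMDl modn_mod eqxx natr1.
rewrite -val_eqE /= => /negPf ic; by rewrite addnC modnMDl (modn_small (ltn_ord i)) ic.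
Qed.

Lemma mean_dvd N m : (0 < N)%N -> (m %| N)%N ->
  (\sum_(0 <= t < N) (m %| t)%N%:R) / N%:R = m%:R^-1 :> R.
Proof.
move=> N0 mN; have m0 := dvdn_gt0 N0 mN; rewrite -{1}(divnK mN).
under eq_bigr => t _ do rewrite /dvdn -(mod0n m).
rewrite sum_class // -{2}(divnK mN) natrM invfM mulrA mulfV ?mul1r //.
by rewrite pnatr_eq0 -lt0n divn_gt0 // dvdn_leq.
Qed.

(* 1 / lcm(x, y) is the density of the common multiples of x and y, so [lcm_sum] is a positive
   semidefinite form. *)
Lemma lcm_sum_cross S T : {in S, forall x, (0 < x)%N} -> {in T, forall x, (0 < x)%N} ->
  2 * lcm_sum S T <= lcm_sum S S + lcm_sum T T.
Proof.
move=> S0 T0; pose N := ((\prod_(x <- S) x) * \prod_(x <- T) x)%N.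
have N0 : (0 < N)%N.
  by rewrite muln_gt0 !big_seq !prodn_cond_gt0.
have SN x : x \in S -> (x %| N)%N.
  by move=> xS; rewrite dvdn_mulr // (big_rem x) //= dvdn_mulr.
have TN x : x \in T -> (x %| N)%N.
  by move=> xS; rewrite dvdn_mull // (big_rem x) //= dvdn_mulr.
pose f (U : seq nat) (t : nat) : R := \sum_(x <- U) (x %| t)%N%:R.
have lcm_sumE U V : {in U, forall x, (x %| N)%N} -> {in V, forall x, (x %| N)%N} ->
   lcm_sum U V = (\sum_(0 <= t < N) f U t * f V t) / N%:R.
  move=> hU hV; rewrite /lcm_sum /f.
  under [X in _ = X / _]eq_bigr => t _ do rewrite mulr_suml.
  rewrite [in RHS]exchange_big mulr_suml /= big_seq [RHS]big_seq; apply: eq_bigr => x xU.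
  under [X in _ = X / _]eq_bigr => t _ do rewrite mulr_sumr.
  rewrite [in RHS]exchange_big mulr_suml /= big_seq [RHS]big_seq; apply: eq_bigr => y yV.
  rewrite /inv_lcm -(@mean_dvd N (lcmn x y)) ?dvdn_lcm ?(hU x) ?(hV y) //; congr (_ / _).
  by apply: eq_bigr => t _; rewrite dvdn_lcm -natrM mulnb.
rewrite !lcm_sumE // -mulrDl mulrA ler_pM2r ?invr_gt0 ?ltr0n // mulr_sumr -big_split /=.
apply: ler_sum => t _; have := sqr_ge0 (f S t - f T t); rewrite sqrrB; nra.
Qed.

End Nu.

Lemma ex_bound (f : nat -> nat) (S : seq nat) : exists K, {in S, forall x, (f x < K.+1)%N}.
Proof.
by exists (\sum_(x <- S) f x)%N => x xS; rewrite ltnS (big_rem x) //= leq_addr.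
Qed.

(** * Adding the prime 5 to the sums of 1 / lcm *)

Section TwoThreeFive.
Variable R : realFieldType.
Local Notation inv_lcm := (@inv_lcm R).
Local Notation lcm_sum := (@lcm_sum R).
Local Notation inv_sum := (@inv_sum R).
Local Notation nu := (@nu R).
Local Notation nu_sum := (@nu_sum R).
Local Notation slice_weight := (@slice_weight R).
Local Notation cost := (@cost R).

Lemma dsum_rec (g : nat -> nat -> R) K :
  \sum_(e < K.+1) \sum_(f < K.+1) g e f =
  \sum_(e < K) \sum_(f < K) g e f + \sum_(e < K) (g e K + g K e) + g K K.
Proof.
rewrite big_ord_recr /= big_ord_recr /=; under eq_bigr => e _ do rewrite big_ord_recr /=.
by rewrite !big_split /=; ring.
Qed.

Lemma slice_weight5 j : slice_weight 5 j = (5 ^+ j)^-1.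
Proof. by rewrite /slice_weight /cost /=; case: eqP => [->|_]; rewrite ?expr0 ?invr1 // natrX mul1r. Qed.

(* AM-GM turns these bounds for the diagonal terms into bounds for all pairs of slices. *)
Definition slice_bound (e : nat) : R := if e == 0%N then 31 / 36 else 7 / 6.

(** 65/36 is the value of the full double series; the subtracted term is its exact tail, which makes
    the induction close. *)
Lemma dsum5 K : \sum_(e < K.+1) \sum_(f < K.+1)
    slice_weight 5 (maxn e f) * ((slice_bound e + slice_bound f) / 2) <=
  65 / 36 - (35 / 12 * K.+1%:R + 65 / 36) / 5 ^+ K.+1.
Proof.
elim: K => [|K IH].
  by rewrite !big_ord1 slice_weight5 /slice_bound /= expr1 expr0; lra.
rewrite (dsum_rec (fun e f => slice_weight 5 (maxn e f) * ((slice_bound e + slice_bound f) / 2))).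
have -> : \sum_(e < K.+1) (slice_weight 5 (maxn e K.+1) * ((slice_bound e + slice_bound K.+1) / 2)
   + slice_weight 5 (maxn K.+1 e) * ((slice_bound K.+1 + slice_bound e) / 2)) =
   (5 ^+ K.+1)^-1 * (7 / 3 * K.+1%:R - 11 / 36).
  rewrite (eq_bigr (fun e : 'I_K.+1 => (5 ^+ K.+1)^-1 * (slice_bound e + 7 / 6))); last first.
    move=> e _; rewrite (maxn_idPr (ltnW (ltn_ord e))) (maxn_idPl (ltnW (ltn_ord e))) slice_weight5 /slice_bound /=.
    by field; rewrite expf_neq0 ?pnatr_eq0.
  rewrite -mulr_sumr; congr (_ * _); rewrite big_ord_recl /slice_bound /=.
  rewrite sumr_const card_ord -[K.+1%:R]natr1 -[X in _ + X]mulr_natr; lra.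
rewrite maxnn slice_weight5 /slice_bound /= (exprS _ K.+1) invfM -[K.+2%:R]natr1 -[K.+1%:R]natr1.
rewrite -[K.+1%:R]natr1 in IH.
have z0 : 0 < (5 ^+ K.+1)^-1 :> R by rewrite invr_gt0 exprn_gt0 //; lra.
move: IH z0; set z := (5 ^+ K.+1)^-1; set V := \sum_(_ < _) _; move=> IH z0.
have k0 : 0 <= K%:R :> R by rewrite ler0n.
nra.
Qed.

Lemma lcm_sum_perm S T : perm_eq S T -> lcm_sum S S = lcm_sum T T.
Proof.
move=> p; rewrite /lcm_sum (perm_big _ p); apply: eq_bigr => x _; exact: perm_big.
Qed.

Lemma perm_rem2 (S : seq nat) x y : x \in S -> y \in S -> x != y ->
  perm_eq S [:: x, y & rem y (rem x S)].
Proof.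
move=> xS yS xy; apply: (perm_trans (perm_to_rem xS)); rewrite perm_cons.
apply: perm_to_rem; have := perm_mem (perm_to_rem xS) y.
by rewrite yS inE eq_sym (negPf xy) /= => <-.
Qed.

Lemma in_rem2 (S : seq nat) x y z : uniq S -> z \in rem y (rem x S) -> [/\ z \in S, z != x & z != y].
Proof.
move=> uS; rewrite mem_rem_uniq ?rem_uniq // inE mem_rem_uniq // inE.
by case/and3P=> zy zx zS.
Qed.

Lemma pow5_of x : (below 7).-nat x -> ~~ (2 %| x)%N -> ~~ (3 %| x)%N -> x = (5 ^ logn 5 x)%N.
Proof.
move=> x7 x2 x3; apply: prime_power_eq (below_gt0 x7) _ => p pp px.
have := px; case: (prime_lt7 pp (below_lt x7 pp px)) => -> //; rewrite ?(negPf x2) ?(negPf x3) //.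
Qed.

(** All other elements are prime to 6, hence powers of 5, so there is at most one. With
    [z = 1 / 5 ^ b <= 1/5] the sum is [7/6 + 8/3 * z], at most 17/10. *)
Lemma lcm_sum_two_three S : primitive S -> smooth 7 S ->
  1%N \notin S -> 2%N \in S -> 3%N \in S -> lcm_sum S S <= 65 / 36.
Proof.
move=> pS sS S1 S2 S3; rewrite (lcm_sum_perm (perm_rem2 S2 S3 isT)).
set T := rem _ _.
have TS z : z \in T -> [/\ z \in S, z != 2%N & z != 3%N] by apply: in_rem2; case: pS.
have pT : primitive T.
  split; first by rewrite !rem_uniq //; case: pS.
  by move=> x y /TS[xS _ _] /TS[yS _ _]; apply: pS.2.
have T5 : {in T, forall x, x = (5 ^ logn 5 x)%N}.
  move=> x /TS[xS x2 x3]; apply: pow5_of (sS x xS) _ _; apply/negP => dx.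
    by move: x2; rewrite -(pS.2 _ _ S2 xS dx) eqxx.
  by move: x3; rewrite -(pS.2 _ _ S3 xS dx) eqxx.
have [|T0|[b bE]] := primitive_powers pT (q := 5).
- by move=> x xT; exists (logn 5 x); apply: T5.
- by rewrite T0 /lcm_sum !big_cons !big_nil /inv_lcm
    (_ : lcmn 2 2 = 2)%N // (_ : lcmn 2 3 = 6)%N //
    (_ : lcmn 3 2 = 6)%N // (_ : lcmn 3 3 = 3)%N //; lra.
have b0 : (0 < b)%N.
  case: b bE => // bE; have /TS[h _ _] : 1%N \in T by rewrite bE inE.
  by rewrite h in S1.
have l n : coprime n 5 -> inv_lcm n (5 ^ b) = n%:R^-1 * (5 ^ b)%:R^-1.
  move=> cn; rewrite /inv_lcm /lcmn; have /eqP -> : coprime n (5 ^ b) by rewrite coprimeXr.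
  by rewrite divn1 natrM invfM.
have z5 : (5 ^ b)%:R^-1 <= 5^-1 :> R.
  by rewrite lef_pV2 ?posrE ?ltr0n ?expn_gt0 // ler_nat -[X in (X <= _)%N]expn1 leq_exp2l.
rewrite bE /lcm_sum !big_cons !big_nil (inv_lcmxx _ (5 ^ b)) !(inv_lcmC _ (5 ^ b)) (l 2) // (l 3) //.
rewrite /inv_lcm (_ : lcmn 2 2 = 2)%N // (_ : lcmn 2 3 = 6)%N //
    (_ : lcmn 3 2 = 6)%N // (_ : lcmn 3 3 = 3)%N //.
lra.
Qed.

Lemma smooth_7_6 S : smooth 7 S -> smooth 6 S.
Proof. by move=> sS x /sS; apply: below_nonprime. Qed.

(** Once sets containing both 2 and 3 are set apart, the slice of exponent 0, which has the largest
    weight, obeys the bound 31/36. Using 7/6 for every slice would give 35/16. *)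
Lemma lcm_sum_le6536 S : primitive S -> smooth 7 S -> lcm_sum S S <= 65 / 36.
Proof.
move=> pS sS; case S1 : (1%N \in S).
  by rewrite (primitive_one pS S1) /lcm_sum !big_seq1 inv_lcmxx; lra.
case S23 : ((2%N \in S) && (3%N \in S)).
  by case/andP: S23 => S2 S3; apply: lcm_sum_two_three; rewrite ?S1.
have [K hK] := ex_bound (logn 5) S; have sS6 := smooth_7_6 sS.
rewrite -nu_sum_lcm_sum // (nu_sum_slice R (q := 5) (K := K.+1)) //.
have sl e : smooth 5 (slice 5 e S) by apply: smooth_slice.
have pl e := primitive_slice 5 e pS.
have sub0 x : x \in slice 5 0 S -> x \in S.
  by case/sliceP => y yS [_ yE]; rewrite expn0 mul1n in yE; rewrite -yE.
have hb e : lcm_sum (slice 5 e S) (slice 5 e S) <= slice_bound e.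
  rewrite /slice_bound; case: eqP => [->|_]; last exact: lcm_sum_le76.
  apply: lcm_sum_le3136 => //; first by apply/negP => /sub0; rewrite S1.
  by apply/negP => /andP[/sub0 h2 /sub0 h3]; rewrite h2 h3 in S23.
have sl7 e : smooth 7 (slice 5 e S).
  by move=> x /sl h; apply: sub_in_pnat h => p _; rewrite !inE /= => /ltn_trans; apply.
apply: le_trans (_ : 65 / 36 - (35 / 12 * K.+1%:R + 65 / 36) / 5 ^+ K.+1 <= _); last first.
  have k0 : 0 <= K.+1%:R :> R by rewrite ler0n.
  by rewrite lerBlDr lerDl mulr_ge0 ?invr_ge0 ?exprn_ge0 //; lra.
apply: le_trans (dsum5 K); apply: ler_sum => e _; apply: ler_sum => f _.
apply: ler_wpM2l; first by rewrite slice_weight5 invr_ge0 exprn_ge0 //; lra.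
rewrite nu_sum_lcm_sum //; have := hb e; have := hb f.
have := @lcm_sum_cross R (slice 5 e S) (slice 5 f S)
  (fun x h => below_gt0 (sl e x h)) (fun x h => below_gt0 (sl f x h)).
lra.
Qed.

End TwoThreeFive.

(** * Density of the {2,3,5}-smooth moduli, and second moments at the primes from 7 on *)

Definition mixed (S : seq nat) := {in S, forall x q b, prime q -> x <> (q ^ b)%N}.

Section Moments.
Variable R : realFieldType.
Local Notation inv_lcm := (@inv_lcm R).
Local Notation lcm_sum := (@lcm_sum R).
Local Notation inv_sum := (@inv_sum R).
Local Notation nu := (@nu R).
Local Notation nu_sum := (@nu_sum R).
Local Notation slice_weight := (@slice_weight R).
Local Notation cost := (@cost R).

Lemma inv_sum_slice K S : {in S, forall x, (logn 5 x < K)%N} ->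
  inv_sum S = \sum_(e < K) (5 ^+ e)^-1 * inv_sum (slice 5 e S).
Proof.
move=> hS; rewrite /inv_sum (slice_sum _ hS); apply: eq_bigr => e _.
by rewrite mulr_sumr; apply: eq_bigr => y _; rewrite natrM invfM natrX.
Qed.

(** A number [2 ^ i * 3 ^ j] that is not a prime power is a multiple of 6. *)
Lemma inv_sum_mixed5 S : primitive S -> smooth 5 S -> mixed S -> inv_sum S <= 1 / 6.
Proof.
move=> pS sS mS; apply: inv_sum_six => // x xS; rewrite (@Gauss_dvd 2 3) //.
have xE := below5_eq (sS x xS); rewrite {1}xE.
case: (posnP (logn 2 x)) => [l2|l2].
  by case: (mS x xS 3%N (logn 3 x)) => //; rewrite {1}xE l2 mul1n.
case: (posnP (logn 3 x)) => [l3|l3].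
  by case: (mS x xS 2%N (logn 2 x)) => //; rewrite {1}xE l3 muln1.
rewrite dvdn_mulr ?dvdn_exp //= {1}xE.
by rewrite dvdn_mull ?dvdn_exp.
Qed.

(** The three constants come from the exponents 0, 1 and at least 2 of 5, the last being
    [5/6 * (1/25 + 1/125 + ...)]. Their sum 119/360 is just below 1/3. *)
Lemma weighted_tail_le K (c : nat -> R) : c 0%N <= 1 / 6 -> c 1%N <= 11 / 18 -> (forall e, c e.+2 <= 5 / 6) ->
  \sum_(e < K.+2) (5 ^+ e)^-1 * c e <= 1 / 6 + 11 / 90 + 1 / 24 - 25 / 24 * (5 ^+ K.+2)^-1.
Proof.
move=> c0 c1 c2; elim: K => [|K IH].
  by rewrite big_ord_recr big_ord1 /= expr0 expr1 !exprS expr0; lra.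
have -> : \sum_(e < K.+3) (5 ^+ e)^-1 * c e = \sum_(e < K.+2) (5 ^+ e)^-1 * c e + (5 ^+ K.+2)^-1 * c K.+2.
  by rewrite big_ord_recr.
have zE : (5 ^+ K.+3)^-1 = 5^-1 * (5 ^+ K.+2)^-1 :> R by rewrite -invfM -exprS.
rewrite zE.
have z0 : 0 < (5 ^+ K.+2)^-1 :> R by rewrite invr_gt0 exprn_gt0 //; lra.
have := c2 K; move: IH z0; set z := (5 ^+ K.+2)^-1; set V := \sum_(_ < _) _; move=> IH z0 h.
have := ler_wpM2l (ltW z0) h. lra.
Qed.

(** Slicing by the exponent of 5 suffices unless 10 and 15 both occur. Then these two contribute
    1/6, any further multiple of 5 would be a power of 5, and the remaining {2,3}-smooth elements
    contribute at most another 1/6. *)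
Lemma inv_sum_mixed S : primitive S -> smooth 7 S -> mixed S -> inv_sum S <= 1 / 3.
Proof.
move=> pS sS mS; have sS6 := smooth_7_6 sS.
have sl e : smooth 5 (slice 5 e S) by apply: smooth_slice.
have pl e := primitive_slice 5 e pS.
have [K hK] := ex_bound (logn 5) S.
have m0 : mixed (slice 5 0 S).
  by move=> x /sliceP[y yS [_ yE]]; rewrite expn0 mul1n in yE; rewrite -yE; apply: mS.
have no1 e : 1%N \notin slice 5 e S.
  by apply/negP => /sliceP[y yS [_ yE]]; apply: (mS y yS 5%N e) => //; rewrite yE muln1.
have F0 := inv_sum_mixed5 (pl 0%N) (sl 0%N) m0.
have hK2 : {in S, forall x, (logn 5 x < K.+2)%N} by move=> x /hK; lia.
case h : ((2%N \in slice 5 1 S) && (3%N \in slice 5 1 S)); last first.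
  rewrite (inv_sum_slice hK2); apply: le_trans (@weighted_tail_le K (fun e => inv_sum (slice 5 e S)) F0 _ _) _.
  - by apply: inv_sum_le1118; rewrite ?h.
  - by move=> e; apply: inv_sum_le56.
  have z0 : 0 < (5 ^+ K.+2)^-1 :> R by rewrite invr_gt0 exprn_gt0 //; lra.
  lra.
case/andP: h => /sliceP[x S10 [_ xE]] /sliceP[y S15 [_ yE]].
rewrite expn1 in xE yE; rewrite {x}xE in S10; rewrite {y}yE in S15.
rewrite /inv_sum (perm_big _ (perm_rem2 S10 S15 isT)) !big_cons /=.
set T := rem _ _.
have TS z : z \in T -> [/\ z \in S, z != (5 * 2)%N & z != (5 * 3)%N] by apply: in_rem2; case: pS.
have pT : primitive T.
  split; first by rewrite !rem_uniq //; case: pS.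
  by move=> x y /TS[xS _ _] /TS[yS _ _]; apply: pS.2.
have mT : mixed T by move=> x /TS[xS _ _]; apply: mS.
have sT : smooth 5 T.
  move=> x xT; have [xS x10 x15] := TS x xT; have x7 := sS x xS.
  apply: belowI => [|p pp px]; first exact: below_gt0 x7.
  have := px; case: (prime_lt7 pp (below_lt x7 pp px)) => -> // x5.
  have x2 : ~~ (2 %| x)%N.
    apply/negP => x2; move: x10; rewrite (pS.2 _ _ S10 xS) ?eqxx //.
    by rewrite (@Gauss_dvd 5 2) // x5.
  have x3 : ~~ (3 %| x)%N.
    apply/negP => x3; move: x15; rewrite (pS.2 _ _ S15 xS) ?eqxx //.
    by rewrite (@Gauss_dvd 5 3) // x5.
  by case: (mS x xS 5%N (logn 5 x)) => //; apply: pow5_of.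
have := inv_sum_mixed5 pT sT mT; rewrite /inv_sum -/T; lra.
Qed.

(** The sum of [slice_weight q (maxn e f)] over all pairs: [2 * j + 1] pairs have maximum [j], and
    the series of [(2 * j + 1) / q ^ j] over [j >= 1] equals [(3 * q - 1) / (q - 1) ^ 2]. *)
Definition growth (q : nat) : R := 1 + 4 / 3 * (3 * q%:R - 1) / (q%:R - 1) ^+ 2.
Definition Growth (k : nat) : R := \prod_(7 <= q < k | prime q) growth q.

Lemma le_of_eq (x y : R) : x = y -> x <= y.
Proof. by move->. Qed.

Lemma dsum_slice_weight q K : (7 <= q)%N ->
  \sum_(e < K.+1) \sum_(f < K.+1) slice_weight q (maxn e f) <= growth q.
Proof.
move=> q7; pose u : R := q%:R - 1.
have u0 : 6 <= u by rewrite /u lerBrDr -[X in _ + X]/(1%:R) -natrD ler_nat.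
have qE : q%:R = u + 1 by rewrite /u subrK.
have weightE j : slice_weight q j.+1 = 4 / 3 * ((u + 1) ^+ j.+1)^-1 by rewrite /slice_weight /cost q7 natrX qE.
(* The subtracted term is the exact tail of the series, so the induction step is an identity. *)
suff h : \sum_(e < K.+1) \sum_(f < K.+1) slice_weight q (maxn e f) <=
   growth q - 4 / 3 * ((u + 1) ^+ K.+1)^-1 * ((2 * K.+1%:R + 1) * (u + 1) / u + 2 * (u + 1) / u ^+ 2).
  apply: le_trans h _; rewrite gerBl.
  have k0 : 0 <= K.+1%:R :> R by rewrite ler0n.
  by rewrite !mulr_ge0 ?addr_ge0 ?mulr_ge0 ?invr_ge0 ?exprn_ge0 //; lra.
elim: K => [|K IH].
  rewrite !big_ord1 /slice_weight /= /growth qE expr1.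
  have -> : u + 1 - 1 = u by ring.
  apply: le_of_eq; field; rewrite ?andbT; apply/andP; split; apply/eqP; lra.
rewrite (dsum_rec (fun e f => slice_weight q (maxn e f))) maxnn weightE.
rewrite [X in _ + X + _](eq_bigr (fun e : 'I_K.+1 => 2 * (4 / 3 * ((u + 1) ^+ K.+1)^-1))); last first.
  move=> e _; rewrite /= (maxn_idPr (ltnW (ltn_ord e))) (maxn_idPl (ltnW (ltn_ord e))) weightE; ring.
rewrite sumr_const card_ord -[X in _ + X + _]mulr_natr (exprS _ K.+1) invfM -[K.+2%:R]natr1.
move: IH; set z := ((u + 1) ^+ K.+1)^-1; set V := \sum_(_ < _) _; set k : R := K.+1%:R => IH.
rewrite -subr_ge0 in IH; rewrite -subr_ge0; apply: le_trans IH _; apply: le_of_eq.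
field; apply/andP; split; apply/eqP; lra.
Qed.

Lemma growth_ge1 q : (7 <= q)%N -> 1 <= growth q.
Proof.
move=> q7; rewrite lerDl.
have : 7 <= q%:R :> R by rewrite ler_nat.
by move=> h; rewrite !mulr_ge0 ?invr_ge0 ?exprn_ge0 //; lra.
Qed.

Lemma Growth_ge1 k : 1 <= Growth k.
Proof.
rewrite /Growth big_nat_cond; elim/big_ind: _ => // [x y hx hy|q].
  by rewrite (le_trans hx) // ler_peMr // (le_trans _ hx).
by case/andP=> /andP[q7 _] _; apply: growth_ge1.
Qed.

Lemma GrowthS k : (7 <= k)%N -> Growth k.+1 = Growth k * (if prime k then growth k else 1).
Proof. by move=> k7; rewrite /Growth big_mkcond big_nat_recr // -big_mkcond. Qed.

Lemma slice_div q e S : prime q -> smooth q.+1 S -> {in slice q e S, forall y, logn q (q ^ e * y) = e}.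
Proof. by move=> pq sS y /sliceP[x xS [<- <-]]. Qed.

(** One prime is peeled off per step. Two sets are allowed because slices of different exponents
    meet in the recursion; [lcm_sum_cross] settles the base case. *)
Lemma nu_sum_le_Growth k S T : (7 <= k)%N -> primitive S -> primitive T -> smooth k S -> smooth k T ->
  nu_sum S T <= 65 / 36 * Growth k.
Proof.
move=> k7; rewrite -(subnKC k7); elim: (k - 7)%N S T => [|n IH] S T pS pT sS sT.
  rewrite addn0 in sS sT *; rewrite /Growth big_geq // mulr1 nu_sum_lcm_sum //.
  have := lcm_sum_le6536 R pS sS; have := lcm_sum_le6536 R pT sT.
  have := @lcm_sum_cross R S T (fun x h => below_gt0 (sS x h)) (fun x h => below_gt0 (sT x h)).
  lra.
rewrite addnS in sS sT *; rewrite GrowthS ?leq_addr //; case: ifP => [pk|/negbT nk]; last first.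
  by rewrite mulr1; apply: IH => // x xS; apply: below_nonprime => //; [apply: sS | apply: sT].
set k' := (7 + n)%N in sS sT pk IH *.
have [K hK] := ex_bound (logn k') (S ++ T).
rewrite (nu_sum_slice R (K := K.+1) pk) //; try by move=> x xS; apply: hK; rewrite mem_cat xS ?orbT.
apply: le_trans (_ : (\sum_(e < K.+1) \sum_(f < K.+1) slice_weight k' (maxn e f)) *
  (65 / 36 * Growth k') <= _).
  rewrite mulr_suml; apply: ler_sum => e _; rewrite mulr_suml; apply: ler_sum => f _.
  apply: ler_wpM2l.
    by rewrite /slice_weight; case: eqP => // _; rewrite divr_ge0 // (le_trans _ (cost_ge1 _ _)).
  by apply: IH; first [exact: primitive_slice | exact: smooth_slice].
rewrite mulrC mulrA; apply: ler_wpM2l; last by apply: dsum_slice_weight; rewrite leq_addr.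
by have := Growth_ge1 k'; lra.
Qed.

Lemma geom_le p K : (7 <= p)%N -> \sum_(1 <= e < K.+1) (p%:R ^+ e)^-1 <= (p%:R - 1)^-1 :> R.
Proof.
move=> p7; have h : 7 <= p%:R :> R by rewrite ler_nat.
suff h' : \sum_(1 <= e < K.+1) (p%:R ^+ e)^-1 <= (p%:R - 1)^-1 - (p%:R ^+ K)^-1 * (p%:R - 1)^-1 :> R.
  by apply: le_trans h' _; rewrite gerBl mulr_ge0 ?invr_ge0 ?exprn_ge0 //; lra.
elim: K => [|K IH]; first by rewrite big_geq // expr0 invr1; lra.
rewrite big_nat_recr //= (exprS _ K) invfM.
move: IH; set z := (p%:R ^+ K)^-1; set V := \sum_(_ <= _ < _) _ => IH.
rewrite -subr_ge0 in IH; rewrite -subr_ge0; apply: le_trans IH _; apply: le_of_eq.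
by field; apply/andP; split; apply/eqP; lra.
Qed.

(** For fixed exponents of [p] both slices are antichains with all primes below [p], so the inner
    sum is at most [65/36 * Growth p]. The exponents are positive and contribute the square of
    [1/p + 1/p^2 + ... = 1/(p - 1)]. *)
Lemma second_moment p S : prime p -> (7 <= p)%N -> primitive S -> smooth p.+1 S ->
  {in S, forall x, (p %| x)%N} ->
  \sum_(x <- S) \sum_(y <- S) (p%:R ^+ logn p x)^-1 * (p%:R ^+ logn p y)^-1 *
     nu (lcmn (x %/ p ^ logn p x) (y %/ p ^ logn p y))
  <= 65 / 36 * Growth p / (p%:R - 1) ^+ 2.
Proof.
move=> pp p7 pS sS hp; have [K hK] := ex_bound (logn p) S.
have sl e y : y \in slice p e S -> logn p (p ^ e * y) = e /\ ((p ^ e * y) %/ p ^ e = y)%N.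
  move=> yS; split; first exact: slice_div yS.
  by rewrite mulKn // expn_gt0 prime_gt0.
have -> : \sum_(x <- S) \sum_(y <- S) (p%:R ^+ logn p x)^-1 * (p%:R ^+ logn p y)^-1 *
     nu (lcmn (x %/ p ^ logn p x) (y %/ p ^ logn p y)) =
   \sum_(e < K.+1) \sum_(f < K.+1) (p%:R ^+ e)^-1 * (p%:R ^+ f)^-1 * nu_sum (slice p e S) (slice p f S).
  rewrite (slice_sum _ hK); apply: eq_bigr => e _.
  under eq_bigr => y _ do rewrite (slice_sum _ hK).
  rewrite exchange_big; apply: eq_bigr => f _; rewrite mulr_sumr.
  rewrite big_seq [RHS]big_seq; apply: eq_bigr => y /sl[y1 y2]; rewrite mulr_sumr.
  rewrite big_seq [RHS]big_seq; apply: eq_bigr => z /sl[z1 z2].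
  by rewrite y1 z1 y2 z2.
have s0 : slice p 0 S = [::].
  rewrite /slice; case E : (filter _ S) => [|x s] //.
  have : x \in filter (fun x => logn p x == 0%N) S by rewrite E mem_head.
  rewrite mem_filter => /andP[l0 xS]; have := hp x xS.
  by have := pfactor_dvdn 1 pp (below_gt0 (sS x xS)); rewrite expn1 (eqP l0) => ->.
have q1 : 7 <= p%:R :> R by rewrite ler_nat.
pose z e : R := if e == 0%N then 0 else (p%:R ^+ e)^-1.
have z0 e : 0 <= z e by rewrite /z; case: eqP => // _; rewrite invr_ge0 exprn_ge0 //; lra.
have zs : \sum_(e < K.+1) z e <= (p%:R - 1)^-1.
  apply: le_trans (geom_le K p7); rewrite -(big_mkord xpredT z) big_ltn // /z /= add0r.
  by rewrite !big_nat; apply: ler_sum => e /andP[e1 _]; rewrite gtn_eqF.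
apply: le_trans (_ : (\sum_(e < K.+1) z e) * (\sum_(f < K.+1) z f) * (65 / 36 * Growth p) <= _).
  rewrite mulr_suml mulr_suml; apply: ler_sum => e _; rewrite mulr_sumr mulr_suml; apply: ler_sum => f _.
  rewrite /z; case: eqP => [->|_]; first by rewrite s0 /nu_sum big_nil !mul0r mulr0.
  case: eqP => [->|_].
    by rewrite s0 /nu_sum big1 ?mulr0 ?mul0r // => x _; rewrite big_nil.
  apply: ler_wpM2l; first by rewrite mulr_ge0 // invr_ge0 exprn_ge0 //; lra.
  by apply: nu_sum_le_Growth => //; first [exact: primitive_slice | exact: smooth_slice].
rewrite mulrC; apply: ler_wpM2l; first by have := Growth_ge1 p; lra.
have s1 : 0 <= \sum_(e < K.+1) z e by apply: sumr_ge0.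
rewrite -exprVn expr2; exact: ler_pM.
Qed.

End Moments.

(** * The distortion step *)

Lemma eqmod_lcm x y m n : x = y %[mod m] -> x = y %[mod n] -> x = y %[mod lcmn m n].
Proof.
wlog xy : x y / (y <= x)%N => [hw|].
  by case/orP: (leq_total y x) => h hm hn; [apply: hw | apply/esym/hw].
by move=> /eqP hm /eqP hn; apply/eqP; move: hm hn; rewrite !eqn_mod_dvd // dvdn_lcm => -> ->.
Qed.

Lemma eqmod_mul_coprime q c x y : coprime q c -> (x * c = y * c %[mod q] -> x = y %[mod q])%N.
Proof.
wlog xy : x y / (y <= x)%N => [hw|].
  by case/orP: (leq_total y x) => h hc e; [apply: hw | apply/esym/hw].
move=> hc /eqP; rewrite eqn_mod_dvd ?leq_mul2r ?xy ?orbT // -mulnBl Gauss_dvdl // => h.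
by apply/eqP; rewrite eqn_mod_dvd.
Qed.

Lemma eqmod_dvd x y m n : (m %| n)%N -> x = y %[mod n] -> x = y %[mod m].
Proof. by move=> mn e; rewrite -(modn_dvdm x mn) e modn_dvdm. Qed.

Lemma eqmod_add x y t q : (x + t = y + t %[mod q] -> x = y %[mod q])%N.
Proof. by move/eqP; rewrite eqn_modDr => /eqP. Qed.

Section Distortion.
Variable R : realFieldType.
Local Notation nu := (@nu R).
Local Notation inv_sum := (@inv_sum R).
Implicit Types f g w : nat -> R.

Lemma sum_shift N f t : (forall x, f (x + N)%N = f x) ->
  \sum_(0 <= x < N) f (x + t)%N = \sum_(0 <= x < N) f x.
Proof.
move=> fN; elim: t => [|t <-]; first by apply: eq_bigr => x _; rewrite addn0.
case: N fN => [|N] fN; first by rewrite !big_geq.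
rewrite big_nat_recr // [RHS]big_nat_recl //= addrC add0n; congr (_ + _).
  by rewrite addnS -addSn addnC fN.
by apply: eq_bigr => x _; rewrite addnS.
Qed.

Section Period.
Variable Q : nat.
Hypothesis Q0 : (0 < Q)%N.

Definition mean f : R := (\sum_(0 <= x < Q) f x) / Q%:R.

(** By the Chinese remainder theorem, translation by [step p] changes only the residue modulo the
    [p]-part of [Q]; its orbits are the fibres over all other coordinates. *)
Definition step (p : nat) := (Q`_p^')%N.
Definition favg (p : nat) f x : R := (\sum_(0 <= t < Q`_p) f (x + t * step p)%N) / (Q`_p)%:R.

Let Qr0 : 0 < Q%:R :> R. Proof. by rewrite ltr0n. Qed.
Let P0 (p : nat) : (0 < Q`_p)%N. Proof. exact: part_gt0. Qed.
Let Pr0 (p : nat) : 0 < (Q`_p)%:R :> R. Proof. by rewrite ltr0n. Qed.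
Let PT (p : nat) : (Q`_p * step p)%N = Q. Proof. exact: partnC. Qed.

Lemma ler_mean f g : (forall x, f x <= g x) -> mean f <= mean g.
Proof. by move=> fg; rewrite ler_pM2r ?invr_gt0 // ler_sum. Qed.

Lemma eq_mean f g : (forall x, f x = g x) -> mean f = mean g.
Proof. by move=> fg; congr (_ / _); apply: eq_bigr. Qed.

Lemma meanZ c f : mean (fun x => c * f x) = c * mean f.
Proof. by rewrite /mean -mulr_sumr mulrA. Qed.

Lemma meanB f g : mean (fun x => f x - g x) = mean f - mean g.
Proof. by rewrite /mean sumrB mulrBl. Qed.

Lemma mean_sum (J : finType) (A : pred J) (F : J -> nat -> R) :
  mean (fun x => \sum_(j | A j) F j x) = \sum_(j | A j) mean (F j).
Proof. by rewrite /mean exchange_big mulr_suml. Qed.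

Lemma inv_mul g s t : (forall x, g (x + s)%N = g x) -> forall x, g (x + t * s)%N = g x.
Proof. by move=> gs; elim: t => [|t IH] x; rewrite ?addn0 // mulSn addnA IH gs. Qed.

Lemma favg_inv p f : (forall x, f (x + Q)%N = f x) ->
  forall x, favg p f (x + step p)%N = favg p f x.
Proof.
move=> fQ x; congr (_ / _).
rewrite -[RHS](@sum_shift (Q`_p) (fun t => f (x + t * step p)%N) 1); last first.
  by move=> t; rewrite mulnDl PT addnA fQ.
by apply: eq_bigr => t _; rewrite addn1 mulSn addnA.
Qed.

(** Fibre averaging is a conditional expectation: against functions constant on fibres it does not
    change the mean. *)
Lemma mean_favg p g f : (forall x, g (x + step p)%N = g x) -> (forall x, f (x + Q)%N = f x) ->
  mean (fun x => g x * favg p f x) = mean (fun x => g x * f x).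
Proof.
move=> gT fQ; rewrite /mean /favg; congr (_ / _).
under eq_bigr => x _ do rewrite mulrA mulr_sumr.
rewrite -mulr_suml exchange_big /=.
rewrite (eq_bigr (fun _ => \sum_(0 <= x < Q) g x * f x)).
  by rewrite sumr_const_nat subn0 -[X in X / _]mulr_natr mulfK // gt_eqF.
move=> t _; rewrite -(@sum_shift Q (fun x => g x * f x) (t * step p)).
  by apply: eq_bigr => x _; rewrite (inv_mul _ gT).
by move=> x; rewrite fQ -(PT p) (inv_mul _ gT).
Qed.

Lemma favg_bounds p f : (forall x, 0 <= f x <= 1) -> forall x, 0 <= favg p f x <= 1.
Proof.
move=> hf x; rewrite divr_ge0 ?ler0n ?sumr_ge0 //=; last by move=> t _; case/andP: (hf (x + t * step p)%N).
rewrite ler_pdivrMr // mul1r; apply: le_trans (_ : \sum_(0 <= t < Q`_p) 1 <= _).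
  by apply: ler_sum => t _; case/andP: (hf (x + t * step p)%N).
by rewrite sumr_const_nat subn0.
Qed.

(* Off b the density is renormalised along each fibre of translations by [step p]; capping the
   factor at 4/3 loses mass only where the fibre average of b exceeds 1/4. *)
Definition distort p w (b : nat -> R) x : R :=
  w x * (1 - b x) / (1 - Num.min (favg p b x) (1 / 4)).

Section Distort.
Variables (p : nat) (w b : nat -> R).
Hypothesis w0 : forall x, 0 <= w x.
Hypothesis wT : forall x, w (x + step p)%N = w x.
Hypothesis b01 : forall x, 0 <= b x <= 1.
Hypothesis bQ : forall x, b (x + Q)%N = b x.
Local Notation al := (favg p b).

Let den x : 3 / 4 <= 1 - Num.min (al x) (1 / 4) <= 1.
Proof.
have /andP[h0 h1] := favg_bounds p b01 x.
have m1 : Num.min (al x) (1 / 4) <= 1 / 4 by rewrite ge_min lexx orbT.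
have m0 : 0 <= Num.min (al x) (1 / 4) by rewrite le_min h0 /=; lra.
by apply/andP; split; lra.
Qed.

Let den_gt0 x : 0 < 1 - Num.min (al x) (1 / 4).
Proof. by have /andP[h _] := den x; lra. Qed.

Lemma distort_ge0 x : 0 <= distort p w b x.
Proof.
have /andP[h0 h1] := b01 x; rewrite /distort.
by apply: divr_ge0 (ltW (den_gt0 x)); apply: mulr_ge0; rewrite ?subr_ge0.
Qed.

Lemma distort_le g : (forall x, 0 <= g x) ->
  mean (fun x => g x * distort p w b x) <= 4 / 3 * mean (fun x => g x * w x).
Proof.
move=> g0; rewrite -meanZ; apply: ler_mean => x; rewrite [4 / 3 * (_ * _)]mulrCA; apply: ler_wpM2l => //.
rewrite /distort -mulrA [4 / 3 * _]mulrC; apply: ler_wpM2l => //.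
rewrite ler_pdivrMr //; have /andP[h0 h1] := b01 x; have /andP[h2 h3] := den x; lra.
Qed.

Lemma mean_distort g : (forall x, g (x + step p)%N = g x) ->
  mean (fun x => g x * distort p w b x) =
  mean (fun x => g x * w x * ((1 - al x) / (1 - Num.min (al x) (1 / 4)))).
Proof.
move=> gT; have alT := favg_inv p bQ.
have fE x : favg p (fun x => 1 - b x) x = 1 - al x.
  by rewrite /favg sumrB sumr_const_nat subn0 mulrBl mulfV // gt_eqF.
rewrite (@eq_mean _ (fun x => (g x * w x / (1 - Num.min (al x) (1 / 4))) * (1 - b x))); last first.
  by move=> x; rewrite /distort; ring.
rewrite -(@mean_favg p); first by apply: eq_mean => x; rewrite fE; ring.
  by move=> x; rewrite gT wT alT.
by move=> x; rewrite bQ.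
Qed.

(** A function constant on fibres sees only the fibre mass, which does not increase. Hence classes
    with modulus prime to [p] pay no factor 4/3. *)
Lemma distort_le_inv g : (forall x, 0 <= g x) -> (forall x, g (x + step p)%N = g x) ->
  mean (fun x => g x * distort p w b x) <= mean (fun x => g x * w x).
Proof.
move=> g0 gT; rewrite mean_distort //; apply: ler_mean => x.
rewrite -[X in _ <= X]mulr1; apply: ler_wpM2l; first by rewrite mulr_ge0.
rewrite ler_pdivrMr // [1 * (_ - _)]mul1r.
have mal : Num.min (al x) (1 / 4) <= al x by rewrite ge_min lexx.
lra.
Qed.

Lemma distort_mass : mean w - 4 / 3 * mean (fun x => w x * al x ^+ 2) <= mean (distort p w b).
Proof.
rewrite (@eq_mean (distort p w b) (fun x => 1 * distort p w b x)); last by move=> x; rewrite mul1r.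
rewrite (@mean_distort (fun=> 1)) // -meanZ -meanB; apply: ler_mean => x.
have -> : w x - 4 / 3 * (w x * al x ^+ 2) = w x * (1 - 4 / 3 * al x ^+ 2) by ring.
rewrite [1 * _]mul1r; apply: ler_wpM2l => //; rewrite ler_pdivlMr //.
have /andP[h0 h1] := favg_bounds p b01 x.
(* For [a > 1/4] the claim amounts to [(a - 1/2) ^ 2 >= 0], for [a <= 1/4] to
   [a ^ 2 * (1 - a) >= 0]. *)
have := sqr_ge0 (al x - 1 / 2); move: (al x) h0 h1 => a h0 h1; rewrite sqrrB => h2.
case: (lerP a (1 / 4)) => h.
  rewrite -subr_ge0; have : 0 <= a ^+ 2 * (1 - a) by rewrite mulr_ge0 ?exprn_ge0 //; lra.
  lra.
lra.
Qed.
End Distort.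
End Period.
End Distortion.

(** * Removing the progressions prime by prime *)

Lemma dvdn_cofactor p n : (n %/ p ^ logn p n %| n)%N.
Proof. by rewrite -{3}(divnK (pfactor_dvdnn p n)) dvdn_mulr. Qed.

Section Stages.
Variable R : realFieldType.
Local Notation nu := (@nu R).
Local Notation inv_sum := (@inv_sum R).
Local Notation Growth := (@Growth R).
Implicit Types f g w : nat -> R.

Definition class_ind (c m x : nat) : R := (x == c %[mod m])%:R.

Lemma class_ind01 c m x : 0 <= class_ind c m x <= 1.
Proof. by rewrite /class_ind ler0n lern1 leq_b1. Qed.

Lemma class_ind_ge0 c m x : 0 <= class_ind c m x.
Proof. by case/andP: (class_ind01 c m x). Qed.

Lemma class_ind_shift c m s x : (m %| s)%N -> class_ind c m (x + s)%N = class_ind c m x.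
Proof. by move=> /dvdnP[k ->]; rewrite /class_ind addnC modnMDl. Qed.

(** The version of [nu] that is in force when only the primes below [k] have been processed. *)
Definition nu_lt (k m : nat) : R :=
  (\prod_(q <- primes m) (if (7 <= q < k)%N then 4 / 3 else 1)) / m%:R.

Lemma nu_lt_ge0 k m : 0 <= nu_lt k m.
Proof.
rewrite divr_ge0 ?ler0n //; elim/big_ind: _ => [||q _]; first by lra.
- exact: mulr_ge0.
- by case: ifP => _; lra.
Qed.

Lemma nu_lt_below k m : (below k).-nat m -> nu_lt k m = nu m.
Proof.
move=> mk; congr (_ / _); rewrite big_seq [RHS]big_seq; apply: eq_bigr => q.
by rewrite mem_primes /cost => /and3P[pq _ qm]; rewrite (below_lt mk pq qm) andbT.
Qed.

Lemma nu_lt7 m : nu_lt 7 m = m%:R^-1.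
Proof.
rewrite /nu_lt big1 ?mul1r // => q _; case: ifP => // /andP[h1 h2].
by rewrite ltnNge h1 in h2.
Qed.

Lemma nu_ltS k m : (7 <= k)%N -> nu_lt k.+1 m = (if k \in primes m then 4 / 3 else 1) * nu_lt k m.
Proof.
move=> k7; rewrite /nu_lt mulrA; congr (_ / _).
have E q : q != k -> (if (7 <= q < k.+1)%N then 4 / 3 else 1) = (if (7 <= q < k)%N then 4 / 3 else 1) :> R.
  by move=> qk; rewrite (ltnS q k) (leq_eqVlt q k) (negPf qk).
case: ifP => km.
  rewrite !(bigD1_seq k) ?primes_uniq //= ltnn andbF k7 leqnn mul1r; congr (_ * _).
  by apply: eq_bigr => q; apply: E.
rewrite mul1r big_seq [RHS]big_seq; apply: eq_bigr => q qm; apply: E.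
by apply: contraFneq km => <-.
Qed.

Section Cover.
Variables (I : finType) (r d : I -> nat).
Hypothesis d1 : forall i, (1 < d i)%N.
Hypothesis anti : forall i j, (d i %| d j)%N -> i = j.
Hypothesis mix : forall i q b, prime q -> d i <> (q ^ b)%N.

Let Q := (\prod_i d i)%N.
Let Q0 : (0 < Q)%N.
Proof. by rewrite prodn_gt0 // => i; apply: ltn_trans (d1 i). Qed.
Let dQ i : (d i %| Q)%N.
Proof. by rewrite /Q (bigD1 i) //= dvdn_mulr. Qed.

Local Notation mean := (@mean R Q).
Local Notation step := (@step Q).
Local Notation favg := (@favg R Q).

Let d0 i : (0 < d i)%N. Proof. exact: ltn_trans (d1 i). Qed.

Lemma dvd_step p m : prime p -> (m %| Q)%N -> ~~ (p %| m)%N -> (m %| step p)%N.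
Proof.
move=> pp mQ pm; have m0 := dvdn_gt0 Q0 mQ.
rewrite -(@part_pnat_id p^' m); first exact: partn_dvd.
by rewrite p'natE.
Qed.

Lemma mean_class c m : (m %| Q)%N -> mean (class_ind c m) = m%:R^-1.
Proof.
move=> mQ; have m0 := dvdn_gt0 Q0 mQ.
rewrite /mean /class_ind -{1}(divnK mQ) sum_class // -{2}(divnK mQ) natrM invfM mulrA mulfV ?mul1r //.
by rewrite pnatr_eq0 -lt0n divn_gt0 // dvdn_leq.
Qed.

(** If some [x0] lies in both classes, they meet in the class of [x0] modulo the lcm; otherwise the
    mean is 0. *)
Lemma mean_class2_le w c m c' m' k : (forall x, 0 <= w x) ->
  (forall c m, (m %| Q)%N -> mean (fun x => class_ind c m x * w x) <= nu_lt k m) ->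
  (m %| Q)%N -> (m' %| Q)%N ->
  mean (fun x => class_ind c m x * class_ind c' m' x * w x) <= nu_lt k (lcmn m m').
Proof.
move=> w0 H mQ m'Q.
case: (boolP [exists x : 'I_Q, (x == c %[mod m]) && (x == c' %[mod m'])]).
  case/existsP=> x0 /andP[/eqP h1 /eqP h2].
  apply: le_trans (H x0 (lcmn m m') _); last by rewrite dvdn_lcm mQ.
  apply: ler_mean => // x; apply: ler_wpM2r => //; rewrite /class_ind.
  case: eqP => [e1|_]; last by rewrite mul0r ler0n.
  case: eqP => [e2|_]; last by rewrite mulr0 ler0n.
  by rewrite mul1r (eqmod_lcm (y := x0) (m := m) (n := m')) ?eqxx // ?e1 ?e2.
move=> /existsPn ne; rewrite /mean big1_seq ?mul0r ?nu_lt_ge0 // => x /andP[_].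
rewrite mem_index_iota => /andP[_ xQ]; have := ne (Ordinal xQ); rewrite /= /class_ind -natrM mulnb.
by move=> /negPf ->; rewrite mul0r.
Qed.

(** With [d i = m * p ^ e], multiples of [step p] vanish modulo [m] and run uniformly through the
    residues modulo [p ^ e]. A fibre meets the progression only inside the class modulo [m], and
    then in proportion [1 / p ^ e]. *)
Lemma favg_class_le p i x : prime p ->
  favg p (class_ind (r i) (d i)) x <=
  (p%:R ^+ logn p (d i))^-1 * class_ind (r i) (d i %/ p ^ logn p (d i)) x.
Proof.
move=> pp; set e := logn p (d i); set m := (d i %/ p ^ e)%N.
have dE : d i = (m * p ^ e)%N by rewrite divnK // pfactor_dvdnn.
have pe0 : (0 < p ^ e)%N by rewrite expn_gt0 prime_gt0.
have peP : (p ^ e %| Q`_p)%N.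
  by rewrite p_part dvdn_exp2l // dvdn_leq_log.
have pm : ~~ (p %| m)%N.
  apply/negP => pm; have : (p ^ e.+1 %| d i)%N by rewrite dE expnS dvdn_mul.
  by rewrite pfactor_dvdn // ltnn.
have mT : (m %| step p)%N.
  by apply: dvd_step => //; apply: dvdn_trans (dQ i); rewrite dE dvdn_mulr.
have Tp : coprime (p ^ e) (step p).
  by rewrite coprimeXl // prime_coprime // -p'natE // part_pnat.
have h0 : 0 <= (p%:R ^+ e)^-1 * class_ind (r i) m x.
  by rewrite mulr_ge0 ?class_ind_ge0 // invr_ge0 exprn_ge0 ?ler0n.
have Pr : 0 < (Q`_p)%:R :> R by rewrite ltr0n part_gt0.
case: (boolP [exists t : 'I_(Q`_p), x + t * step p == r i %[mod d i]]); last first.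
  move=> /existsPn ne; rewrite /favg big1_seq ?mul0r // => t /andP[_].
  rewrite mem_index_iota => /andP[_ tP]; have := ne (Ordinal tP).
  by rewrite /= /class_ind => /negPf ->.
case/existsP=> t0 /eqP e0.
have xm : x = r i %[mod m].
  have : x + t0 * step p = r i %[mod m].
    by apply: eqmod_dvd e0; rewrite dE dvdn_mulr.
  by have /dvdnP[k ->] := mT; rewrite mulnA addnC modnMDl.
rewrite {2}/class_ind xm eqxx mulr1 /favg ler_pdivrMr //.
apply: le_trans (_ : \sum_(0 <= t < Q`_p) (t == t0 %[mod p ^ e])%:R <= _).
  apply: ler_sum => t _; rewrite /class_ind; case: eqP => [et|_]; last by rewrite ler0n.
  suff -> : (t == t0 %[mod p ^ e]) by [].
  apply/eqP/(eqmod_mul_coprime Tp).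
  apply: (@eqmod_add _ _ x); rewrite ![(_ * _ + x)%N]addnC.
  by apply: eqmod_dvd (etrans et (esym e0)); rewrite dE dvdn_mull.
rewrite -{1}(divnK peP) sum_class // -natrX -[X in _ <= _ * X%:R](divnK peP) natrM.
rewrite mulrCA mulVf ?mulr1 //.
by rewrite pnatr_eq0 -lt0n.
Qed.

Definition hit i x := (x == r i %[mod d i]).
Definition top p : pred I := fun i => (p %| d i)%N && (below p.+1).-nat (d i).
Definition bad p x : R := [exists i, top p i && hit i x]%:R.

Lemma hit_shift i s x : (d i %| s)%N -> hit i (x + s) = hit i x.
Proof. by case/dvdnP=> k ->; rewrite /hit addnC modnMDl. Qed.

Lemma bad01 p x : 0 <= bad p x <= 1.
Proof. by rewrite /bad ler0n lern1 leq_b1. Qed.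

Lemma bad_shift p s x : (forall i, top p i -> (d i %| s)%N) -> bad p (x + s)%N = bad p x.
Proof.
move=> h; rewrite /bad; congr (nat_of_bool _)%:R; apply: eq_existsb => i.
by case: (boolP (top p i)) => //= ti; rewrite hit_shift ?h.
Qed.

Lemma bad_le p x : bad p x <= \sum_(i | top p i) class_ind (r i) (d i) x.
Proof.
rewrite /bad; case: existsP => [[i /andP[ti hi]]|_]; last by rewrite sumr_ge0 // => i _; apply: class_ind_ge0.
rewrite (bigD1 i) //= {1}/class_ind -/(hit i x) hi lerDl sumr_ge0 // => j _; exact: class_ind_ge0.
Qed.

Lemma favg_bad p x : prime p -> favg p (bad p) x <=
  \sum_(i | top p i) (p%:R ^+ logn p (d i))^-1 * class_ind (r i) (d i %/ p ^ logn p (d i)) x.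
Proof.
move=> pp; apply: le_trans (_ : \sum_(i | top p i) favg p (class_ind (r i) (d i)) x <= _); last first.
  by apply: ler_sum => i _; apply: favg_class_le.
rewrite /favg -mulr_suml ler_pM2r ?invr_gt0 ?ltr0n ?part_gt0 // exchange_big /=.
by apply: ler_sum => t _; apply: bad_le.
Qed.

(** Squaring [favg_bad] gives pairs of classes modulo the [p]-free parts of the moduli. These have
    only primes below [p], where [nu_lt p] agrees with [nu], so [second_moment] applies. *)
Lemma second_moment_bad p w : prime p -> (7 <= p)%N -> (forall x, 0 <= w x) ->
  (forall c m, (m %| Q)%N -> mean (fun x => class_ind c m x * w x) <= nu_lt p m) ->
  mean (fun x => w x * favg p (bad p) x ^+ 2) <= 65 / 36 * Growth p / (p%:R - 1) ^+ 2.
Proof.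
move=> pp p7 w0 H.
pose c i : R := (p%:R ^+ logn p (d i))^-1; pose m i := (d i %/ p ^ logn p (d i))%N.
have c0 i : 0 <= c i by rewrite invr_ge0 exprn_ge0 ?ler0n.
have mQ i : (m i %| Q)%N.
  exact: dvdn_trans (dvdn_cofactor p (d i)) (dQ i).
apply: le_trans (_ : \sum_(i | top p i) \sum_(j | top p j) c i * c j * nu_lt p (lcmn (m i) (m j)) <= _).
  apply: le_trans (_ : mean (fun x => \sum_(i | top p i) \sum_(j | top p j)
      c i * c j * (class_ind (r i) (m i) x * class_ind (r j) (m j) x * w x)) <= _).
    apply: ler_mean => // x; have h := favg_bad x pp.
    have /andP[h0 _] := favg_bounds Q p (bad01 p) x.
    rewrite mulrC; apply: le_trans (_ : (\sum_(i | top p i) c i * class_ind (r i) (m i) x) ^+ 2 * w x <= _).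
      by apply: ler_wpM2r => //; rewrite ler_pXn2r // nnegrE // (le_trans h0).
    rewrite expr2 -mulrA mulr_suml; apply: ler_sum => i ti.
    rewrite mulrCA mulr_suml; apply: ler_sum => j tj.
    by apply: le_of_eq; ring.
  rewrite mean_sum; apply: ler_sum => i ti; rewrite mean_sum; apply: ler_sum => j tj.
  by rewrite meanZ; apply: ler_wpM2l; [apply: mulr_ge0 | apply: mean_class2_le].
pose S := [seq d i | i <- enum (top p)].
have injd : injective d by move=> i j e; apply: anti; rewrite e.
have Sin x : x \in S -> exists2 i, top p i & x = d i.
  by case/mapP => i; rewrite mem_enum => ti ->; exists i.
have pS : primitive S.
  split; first by rewrite map_inj_uniq ?enum_uniq.
  by move=> _ _ /Sin[i _ ->] /Sin[j _ ->] /anti ->.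
have sS : smooth p.+1 S by move=> _ /Sin[i /andP[_ h] ->].
have hS : {in S, forall x, (p %| x)%N} by move=> _ /Sin[i /andP[h _] ->].
apply: le_trans (second_moment R pp p7 pS sS hS).
rewrite big_map big_enum; apply: ler_sum => i ti.
rewrite big_map big_enum; apply: ler_sum => j tj.
apply: le_of_eq; congr (_ * _); apply: nu_lt_below.
have mb k : top p k -> (below p).-nat (m k).
  case/andP=> _ hk; apply: belowI => [|q pq qm].
    by rewrite divn_gt0 ?expn_gt0 ?prime_gt0 // dvdn_leq // pfactor_dvdnn.
  have qd : (q %| d k)%N := dvdn_trans qm (dvdn_cofactor p (d k)).
  have := below_lt hk pq qd; rewrite ltnS leq_eqVlt => /orP[/eqP qp|//].
  move: qm; rewrite qp => pm.
  have : (p ^ (logn p (d k)).+1 %| d k)%N.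
    by rewrite -{2}(divnK (pfactor_dvdnn p (d k))) expnS dvdn_mul.
  by rewrite pfactor_dvdn // ltnn.
have mi := mb i ti; have mj := mb j tj.
apply: belowI => [|q pq ql]; first by rewrite lcmn_gt0 !(below_gt0 (k := p)).
have : (q %| m i * m j)%N.
  by apply: dvdn_trans ql _; rewrite dvdn_lcm dvdn_mulr // dvdn_mull.
by rewrite Euclid_dvdM // => /orP[]; apply: below_lt.
Qed.

Definition Loss (k : nat) : R := \sum_(7 <= q < k | prime q) Growth q / (q%:R - 1) ^+ 2.

Lemma LossS k : (7 <= k)%N ->
  Loss k.+1 = Loss k + (if prime k then Growth k / (k%:R - 1) ^+ 2 else 0).
Proof. by move=> k7; rewrite /Loss big_mkcond big_nat_recr // -big_mkcond. Qed.

(** Invariant once all primes below [k] are processed. The third condition says that the remaining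
    coordinates are still undistorted; the fourth feeds the next second moment; 65/27 is
    [4/3 * 65/36]. *)
Definition stage k w := [/\ forall x, 0 <= w x,
  forall x, w x != 0 -> forall i, (below k).-nat (d i) -> ~~ hit i x,
  forall p, prime p -> (k <= p)%N -> forall x, w (x + step p)%N = w x,
  forall c m, (m %| Q)%N -> mean (fun x => class_ind c m x * w x) <= nu_lt k m &
  2 / 3 - 65 / 27 * Loss k <= mean w].

Lemma below_dvd_step k p i : prime p -> (k <= p)%N -> (below k).-nat (d i) -> (d i %| step p)%N.
Proof.
move=> pp kp hi; apply: dvd_step => //; apply/negP => pd.
by have := below_lt hi pp pd; rewrite ltnNge kp.
Qed.

Lemma stage7 : exists w, stage 7 w.
Proof.
pose sm : pred I := fun i => (below 7).-nat (d i).
pose w x : R := (~~ [exists i, sm i && hit i x])%:R.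
have w1 x : 0 <= w x <= 1 by rewrite ler0n lern1 leq_b1.
exists w; split.
- by move=> x; case/andP: (w1 x).
- move=> x wx i si; apply/negP => hi; case/negP: wx.
  by rewrite /w pnatr_eq0 eqb0 negbK; apply/existsP; exists i; rewrite /sm si.
- move=> p pp p7 x; rewrite /w; congr (nat_of_bool (~~ _))%:R; apply: eq_existsb => i.
  case: (boolP (sm i)) => //= si; rewrite hit_shift //; exact: below_dvd_step si.
- move=> c m mQ; rewrite nu_lt7 -(mean_class c mQ); apply: ler_mean => // x.
  by have /andP[_ h] := w1 x; rewrite -[X in _ <= X]mulr1; apply: ler_wpM2l; rewrite ?class_ind_ge0.
rewrite /Loss big_geq // mulr0 subr0.
have F : inv_sum [seq d i | i <- enum sm] <= 1 / 3.
  apply: inv_sum_mixed.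
  - split; first by rewrite map_inj_uniq ?enum_uniq // => i j e; apply: anti; rewrite e.
    by move=> _ _ /mapP[i _ ->] /mapP[j _ ->] /anti ->.
  - by move=> _ /mapP[i + ->]; rewrite mem_enum.
  - by move=> _ /mapP[i _ ->]; apply: mix.
apply: le_trans (_ : mean (fun x => 1 - \sum_(i | sm i) class_ind (r i) (d i) x) <= _).
  rewrite meanB mean_sum.
  have -> : mean (fun=> 1) = 1.
    by rewrite /mean sumr_const_nat subn0 mulfV // pnatr_eq0 -lt0n.
  have -> : \sum_(i | sm i) mean (class_ind (r i) (d i)) = inv_sum [seq d i | i <- enum sm].
    by rewrite /inv_sum big_map big_enum; apply: eq_bigr => i _; rewrite mean_class.
  by lra.
apply: ler_mean => // x; rewrite /w; case: existsP => [[i /andP[si hi]]|_].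
  rewrite subr_le0 (bigD1 i) //= {1}/class_ind -/(hit i x) hi lerDl sumr_ge0 // => j _; exact: class_ind_ge0.
by rewrite gerBl sumr_ge0 // => j _; apply: class_ind_ge0.
Qed.

(** A class modulo [m] is charged 4/3 if [p] divides [m]; otherwise its indicator is constant on the
    fibres and nothing is charged. *)
Lemma stage_prime p w : prime p -> (7 <= p)%N -> stage p w -> stage p.+1 (distort Q p w (bad p)).
Proof.
move=> pp p7 [w0 wA wT wH wM].
have topQ i : top p i -> (d i %| Q)%N by move=> _.
have bQ x : bad p (x + Q)%N = bad p x by apply: bad_shift.
have b01 := bad01 p.
have wTp := wT p pp (leqnn p).
split.
- by move=> x; apply: distort_ge0.
- move=> x nz i hi.
  have wx : w x != 0 by apply: contraNneq nz => w00; rewrite /distort w00 !mul0r.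
  case: (boolP (p %| d i)%N) => pd.
    apply/negP => hx; case/negP: nz; rewrite /distort /bad.
    have -> : [exists i, top p i && hit i x] by apply/existsP; exists i; rewrite /top pd hi.
    by rewrite subrr mulr0 mul0r.
  apply: wA => //; apply: belowI => // q pq qd.
  have := below_lt hi pq qd; rewrite ltnS leq_eqVlt => /orP[/eqP qp|//].
  by rewrite -qp qd in pd.
- move=> q pq pq' x; have bT y : bad p (y + step q)%N = bad p y.
    by apply: bad_shift => i /andP[_ hi]; apply: below_dvd_step hi.
  rewrite /distort wT ?(ltnW pq') // bT; congr (_ / (1 - Num.min _ _)).
  rewrite /favg; congr (_ / _); apply: eq_bigr => t _.
  by rewrite addnAC bT.
- move=> c m mQ; rewrite nu_ltS //; have m0 := dvdn_gt0 Q0 mQ.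
  case: (boolP (p %| m)%N) => pm.
    rewrite mem_primes pp m0 pm /=; apply: le_trans (_ : 4 / 3 * mean (fun x => class_ind c m x * w x) <= _).
      by apply: distort_le => // x; apply: class_ind_ge0.
    by apply: ler_wpM2l; [lra | apply: wH].
  rewrite mem_primes (negPf pm) !andbF mul1r; apply: le_trans (wH c m mQ).
  apply: distort_le_inv => // x; first [exact: class_ind_ge0 | by apply: class_ind_shift; apply: dvd_step].
rewrite LossS // pp.
have := distort_mass Q0 w0 wTp b01 bQ; have := second_moment_bad pp p7 w0 wH.
lra.
Qed.

Lemma stages k : (7 <= k)%N -> exists w, stage k w.
Proof.
move=> k7; rewrite -(subnKC k7); elim: (k - 7)%N => [|n [w IH]]; first exact: stage7.
rewrite addnS; set p := (7 + n)%N in IH *.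
have p7 : (7 <= p)%N by apply: leq_addr.
case: (boolP (prime p)) => pp; first by exists (distort Q p w (bad p)); apply: stage_prime.
exists w; case: IH => [w0 wA wT wH wM]; split => //.
- by move=> x wx i hi; apply: wA => //; apply: below_nonprime.
- by move=> q pq pq'; apply: wT => //; apply: ltnW.
- by move=> c m mQ; rewrite nu_ltS // mem_primes (negPf pp) mul1r; apply: wH.
by rewrite LossS // (negPf pp) addr0.
Qed.

Lemma uncovered : (forall k, 65 / 27 * Loss k < 2 / 3) -> exists x, forall i, ~~ hit i x.
Proof.
(* No prime factor of a modulus exceeds [Q], so at stage [7 + Q] every progression has been
   removed. *)
move=> hL; have [|w [w0 wA _ _ wM]] := @stages (7 + Q) _; first exact: leq_addr.
have M0 : 0 < mean w by apply: lt_le_trans wM; rewrite subr_gt0.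
case: (boolP [exists x : 'I_Q, w x != 0]) => [/existsP[x wx]|/existsPn h]; last first.
  move: M0; rewrite /mean big1_seq ?mul0r ?ltxx // => x /andP[_].
  by rewrite mem_index_iota => /andP[_ xQ]; have := h (Ordinal xQ); rewrite negbK => /eqP.
exists x => i; apply: wA wx _ _; apply: belowI => // p pp pd.
have := dvdn_leq Q0 (dvdn_trans pd (dQ i)); lia.
Qed.

End Cover.
End Stages.

(** * The sum over primes *)

Lemma bin_le_exp n m : ('C(n, m) <= 2 ^ n)%N.
Proof.
elim: n m => [|n IH] [|m]; rewrite ?bin0 ?expn_gt0 //.
by rewrite binS expnS mul2n -addnn leq_add.
Qed.

Lemma prod_primes_dvd (s : seq nat) m : uniq s -> {in s, forall p, prime p /\ (p %| m)%N} ->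
  (\prod_(p <- s) p %| m)%N.
Proof.
elim: s => [|p s IH] /=; first by rewrite big_nil dvd1n.
case/andP=> ps us h; have [pp pm] := h p (mem_head _ _).
have hs q : q \in s -> prime q /\ (q %| m)%N by move=> qs; apply: h; rewrite inE qs orbT.
rewrite big_cons Gauss_dvd ?pm; first exact: IH.
rewrite prime_coprime // Euclid_dvd_prod // big_has; apply/hasPn => q qs.
by rewrite dvdn_prime2 ?(hs q qs).1 //; apply: contraNneq ps => ->.
Qed.

Lemma prime_fact_ndvd p n : prime p -> (n < p)%N -> ~~ (p %| n`!)%N.
Proof.
move=> pp np; rewrite fact_prod Euclid_dvd_prod // big_has; apply/hasPn => q.
by rewrite mem_index_iota => /andP[q1 qn]; rewrite gtnNdvd // (leq_ltn_trans _ np) // -ltnS.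
Qed.

Lemma exp_size_le_prod n (s : seq nat) : {in s, forall p, (n <= p)%N} ->
  (n ^ size s <= \prod_(p <- s) p)%N.
Proof.
elim: s => [|p s IH] h; first by rewrite big_nil.
rewrite big_cons expnS leq_mul ?h ?mem_head // IH // => q qs.
by apply: h; rewrite inE qs orbT.
Qed.

(* The product of the primes in (n, 2n] divides 'C(2n, n), which is at most 4 ^ n. *)
Lemma prime_count t : (0 < t)%N ->
  (t * count prime (index_iota (2 ^ t).+1 (2 * 2 ^ t).+1) <= 2 * 2 ^ t)%N.
Proof.
move=> t0; set n := (2 ^ t)%N; set s := [seq p <- index_iota n.+1 (2 * n).+1 | prime p].
have n0 : (0 < n)%N by rewrite expn_gt0.
have sP p : p \in s -> [/\ prime p, (n < p)%N & (p <= 2 * n)%N].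
  by rewrite mem_filter mem_index_iota ltnS => /and3P[].
rewrite -size_filter -/s -(@leq_exp2l 2) // expnM -/n.
apply: leq_trans (bin_le_exp (2 * n) n).
apply: leq_trans (_ : \prod_(p <- s) p <= _)%N.
  by apply: exp_size_le_prod => p /sP[_ /ltnW].
apply: dvdn_leq; first by rewrite bin_gt0; lia.
apply: prod_primes_dvd => [|p /sP[pp np p2n]]; first by rewrite filter_uniq // iota_uniq.
split=> //; have h : (p %| (2 * n)`!)%N by rewrite dvdn_fact // prime_gt0.
rewrite -(@bin_fact (2 * n) n) in h; last by lia.
rewrite (_ : 2 * n - n = n)%N in h; last by lia.
by move: h; rewrite !Euclid_dvdM // !(negPf (prime_fact_ndvd pp np)) !orbF.
Qed.

(** * Dyadic blocks of primes beyond [2 ^ 16] *)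

Section Tail.
Variable R : realFieldType.
Local Notation Growth := (@Growth R).
Local Notation Loss := (@Loss R).
Local Notation growth := (@growth R).

(** An upper bound for a power that stands in for the exponential function. *)
Lemma bernoulli (x : R) m : 0 <= x -> (1 + x) ^+ m * (1 - m%:R * x) <= 1.
Proof.
move=> x0; elim: m => [|m IH]; first by rewrite expr0; lra.
apply: le_trans IH; rewrite exprSr -mulrA; apply: ler_wpM2l; first by rewrite exprn_ge0 //; lra.
have m0 : 0 <= m%:R :> R by rewrite ler0n.
have := mulr_ge0 m0 (sqr_ge0 x); have := sqr_ge0 x; rewrite -[m.+1%:R]natr1; lra.
Qed.

Lemma prod_le_exp (r : seq nat) (F : nat -> R) x : (forall q, q \in r -> prime q -> 0 <= F q <= 1 + x) ->
  0 <= x -> \prod_(q <- r | prime q) F q <= (1 + x) ^+ count prime r.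
Proof.
move=> h x0; elim: r h => [|q r IH] h; first by rewrite big_nil expr0.
have {}IH : \prod_(q <- r | prime q) F q <= (1 + x) ^+ count prime r.
  by apply: IH => z zr; apply: h; rewrite inE zr orbT.
rewrite big_cons /=; case: ifP => pq; last by rewrite add0n.
rewrite add1n exprS; have /andP[h0 h1] := h q (mem_head _ _) pq.
apply: ler_pM => //; rewrite big_seq_cond; apply: prodr_ge0 => z /andP[zr pz].
by have /andP[] : 0 <= F z <= 1 + x by apply: h; rewrite ?inE ?zr ?orbT.
Qed.

Lemma Growth_cat a b : (7 <= a)%N -> (a <= b)%N ->
  Growth b = Growth a * \prod_(a <= q < b | prime q) growth q.
Proof. by move=> a7 ab; rewrite /Growth (big_cat_nat a7). Qed.

Lemma Growth_mono a b : (7 <= a)%N -> (a <= b)%N -> Growth a <= Growth b.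
Proof.
move=> a7 ab; rewrite (Growth_cat a7 ab) ler_peMr ?(le_trans ler01 (Growth_ge1 _ _)) //.
rewrite big_nat_cond; elim/big_ind: _ => // [x y hx hy|q].
  by rewrite (le_trans hx) // ler_peMr // (le_trans _ hx).
by case/andP=> /andP[q7 _] _; apply: growth_ge1; apply: leq_trans a7 q7.
Qed.

Lemma Loss_mono a b : (7 <= a)%N -> (a <= b)%N -> Loss a <= Loss b.
Proof.
move=> a7 ab; rewrite /Loss (big_cat_nat a7 ab) /= lerDl sumr_ge0 // => q _.
by rewrite divr_ge0 ?exprn_even_ge0 // (le_trans ler01 (Growth_ge1 _ _)).
Qed.

Section Block.
Variable t : nat.
Hypothesis t16 : (16 <= t)%N.
Let n := (2 ^ t)%N.
Let c := count prime (index_iota n.+1 (2 * n).+1).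
(** This is [n / 32]: since [t >= 16], the block contains at most [n / 8 = 4 * m] primes. *)
Let m := (2 ^ (t - 5))%N.

Let nm : n = (32 * m)%N.
Proof. by rewrite /n /m -(@expnD 2 5) subnKC //; lia. Qed.

Let cm : (c <= 4 * m)%N.
Proof.
have h : (t * c <= 2 * n)%N by apply: prime_count; lia.
have : (16 * c <= 2 * n)%N by apply: leq_trans h; rewrite leq_mul2r t16 orbT.
rewrite nm; lia.
Qed.

Let n9 : 512 <= n%:R :> R.
Proof.
rewrite (_ : 512 = 2 ^+ 9); last by ring.
rewrite -natrX ler_nat leq_exp2l //; lia.
Qed.

Let n7 : (7 <= n.+1)%N.
Proof. by rewrite ltnS (leq_trans _ (@leq_pexp2l 2 3 t isT _)) //; lia. Qed.

(** Each of the at most [4 * m] primes has [growth q - 1 <= (4 + 1/16) / n]. Bernoulli's bound is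
    applied to [m] factors and the result raised to the fourth power; applied to all [4 * m] at once
    it would give only 128/63, more than 7/4. *)
Lemma Growth_block : Growth (2 * n).+1 <= 7 / 4 * Growth n.+1.
Proof.
have n9' := n9.
rewrite (Growth_cat n7); last by rewrite ltnS; lia.
rewrite mulrC; apply: ler_wpM2r; first by rewrite (le_trans ler01 (Growth_ge1 _ _)).
pose x : R := 65 / 16 / n%:R.
have x0 : 0 <= x by rewrite !mulr_ge0 ?invr_ge0 //; lra.
apply: le_trans (_ : (1 + x) ^+ c <= _).
  apply: prod_le_exp => // q; rewrite mem_index_iota => /andP[nq _] _.
  have q7 : (7 <= q)%N by apply: leq_trans n7 nq.
  rewrite (le_trans ler01 (growth_ge1 _ q7)) /= /growth lerD2l.
  have hq : n%:R <= q%:R - 1 :> R by rewrite lerBrDr natr1 ler_nat.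
  set u : R := q%:R - 1 in hq *.
  have u0 : 0 < u by lra.
  have -> : 4 / 3 * (3 * q%:R - 1) / u ^+ 2 = (4 + 8 / 3 / u) / u.
    have qE : q%:R = u + 1 by rewrite /u subrK.
    by rewrite qE; field; lra.
  have iu0 : 0 < u^-1 by rewrite invr_gt0.
  have hu : 8 / 3 / u <= 1 / 16 by rewrite ler_pdivrMr //; lra.
  apply: ler_pM; [lra|lra|lra|].
  by rewrite lef_pV2 ?posrE //; lra.
apply: le_trans (_ : (1 + x) ^+ (4 * m) <= _).
  by apply: ler_weXn2l => //; lra.
rewrite mulnC exprM.
have mx : m%:R * x = 65 / 512.
  rewrite /x nm natrM; field; rewrite pnatr_eq0 expn_eq0 //.
have := bernoulli m x0; rewrite mx; set y := (1 + x) ^+ m => hy.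
have y0 : 0 <= y by rewrite exprn_ge0 //; lra.
have y1 : y <= 31 / 27 by lra.
have y2 : y ^+ 2 <= 33 / 25.
  by apply: le_trans (_ : (31 / 27) ^+ 2 <= _); [rewrite ler_pXn2r // nnegrE; lra | lra].
rewrite (@exprM _ y 2 2); apply: le_trans (_ : (33 / 25) ^+ 2 <= _); last by lra.
by rewrite ler_pXn2r // nnegrE ?exprn_ge0 //; lra.
Qed.

Lemma Loss_block : Loss (2 * n).+1 <= Loss n.+1 + Growth (2 * n).+1 / (8 * n%:R).
Proof.
have n9' := n9.
have n2 : (n.+1 <= (2 * n).+1)%N by rewrite ltnS; lia.
rewrite /Loss (big_cat_nat n7 n2) /= lerD2l.
have G0 : 0 <= Growth (2 * n).+1 by rewrite (le_trans ler01 (Growth_ge1 _ _)).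
apply: le_trans (_ : \sum_(n.+1 <= q < (2 * n).+1 | prime q) Growth (2 * n).+1 / n%:R ^+ 2 <= _).
  rewrite big_nat_cond [X in _ <= X]big_nat_cond; apply: ler_sum => q /andP[/andP[nq qn] _].
  apply: ler_pM => //.
  - by rewrite (le_trans ler01 (Growth_ge1 _ _)).
  - by rewrite invr_ge0 exprn_even_ge0.
  - by apply: Growth_mono; [apply: leq_trans n7 nq | apply: ltnW].
  have hq : n%:R <= q%:R - 1 :> R by rewrite lerBrDr natr1 ler_nat.
  rewrite lef_pV2 ?posrE ?exprn_gt0 //; try lra.
  by rewrite ler_pXn2r // nnegrE; lra.
rewrite big_const_seq iter_addr addr0 -/c -[X in X <= _]mulr_natr -mulrA; apply: ler_wpM2l => //.
have -> : (8 * n%:R)^-1 = (n%:R ^+ 2)^-1 * (n%:R / 8) :> R.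
  by field; apply/eqP; lra.
apply: ler_wpM2l; first by rewrite invr_ge0 exprn_even_ge0.
rewrite ler_pdivlMr // -natrM ler_nat nm; have := cm; lia.
Qed.

End Block.

(* The potential Loss + 7/4 * Growth / 2 ^ t at (2 ^ t).+1 does not increase with t. *)
Lemma Loss_bound T k : (16 <= T)%N ->
  Loss (2 ^ T).+1 + 7 / 4 * Growth (2 ^ T).+1 / (2 ^ T)%:R < 18 / 65 -> 65 / 27 * Loss k < 2 / 3.
Proof.
move=> T16 h0.
have inv j : Loss (2 ^ (T + j)).+1 + 7 / 4 * Growth (2 ^ (T + j)).+1 / (2 ^ (T + j))%:R < 18 / 65.
  elim: j => [|j IH]; first by rewrite addn0.
  rewrite addnS expnS; set t := (T + j)%N in IH *.
  have t16 : (16 <= t)%N by apply: leq_trans T16 (leq_addr _ _).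
  have := Loss_block t16; have := Growth_block t16.
  have n0 : 0 < (2 ^ t)%:R :> R by rewrite ltr0n expn_gt0.
  move: IH; set L := Loss _; set G := Growth _; set L' := Loss _; set G' := Growth _.
  rewrite natrM; set n : R := (2 ^ t)%:R in n0 * => IH hG hL.
  have hG' : G' / n <= 7 / 4 * G / n by rewrite ler_pM2r ?invr_gt0.
  (* The new potential is at most [L + (1/8 + 7/8) * G' / n], and [G' <= 7/4 * G] returns the old
     one. *)
  have e1 : G' / (8 * n) = G' / n / 8 by field; apply/eqP; lra.
  have e2 : 7 / 4 * G' / (2 * n) = G' / n * (7 / 8) by field; apply/eqP; lra.
  lra.
have hk : Loss k <= Loss (2 ^ (T + k)).+1.
  case: (leqP 7 k) => k7.
    apply: Loss_mono => //; apply: leqW; apply: leq_trans (ltnW (ltn_expl k (isT : 1 < 2)%N)) _.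
    by rewrite leq_exp2l // leq_addl.
  rewrite /Loss big_geq ?(ltnW k7) // sumr_ge0 // => q _.
  by rewrite divr_ge0 ?exprn_even_ge0 // (le_trans ler01 (Growth_ge1 _ _)).
have : 0 <= 7 / 4 * Growth (2 ^ (T + k)).+1 / (2 ^ (T + k))%:R.
  by rewrite !mulr_ge0 ?invr_ge0 ?ler0n ?(le_trans ler01 (Growth_ge1 _ _)) //; lra.
have := inv k; lra.
Qed.

End Tail.

(** * Certified evaluation up to [2 ^ 16] in integer arithmetic, rounding upwards *)

Fixpoint sieve (l : seq N) (n : N) : bool :=
  if l is q :: l' then if N.eqb (N.modulo n q) 0 then N.eqb n q else sieve l' n else true.

(** Only odd numbers are tested, and the next prime 257 has a square above [2 ^ 16]. *)
Definition small_primes : seq N := [:: 3; 5; 7; 11; 13; 17; 19; 23; 29; 31; 37; 41; 43;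
  47; 53; 59; 61; 67; 71; 73; 79; 83; 89; 97; 101; 103; 107; 109; 113; 127; 131; 137;
  139; 149; 151; 157; 163; 167; 173; 179; 181; 191; 193; 197; 199; 211; 223; 227; 229;
  233; 239; 241; 251]%num.

Definition scale : N := (2 ^ 40)%num.

(* A state (u, P, L) refers to n = u + 1: P and L are upper bounds for Growth n and Loss n in
   units of 1 / scale. *)
Definition advance (s : N * N * N) : N * N * N :=
  let: (u, P, L) := s in
  if sieve small_primes (N.succ u) then
    let uu := (u * u)%num in
    ((u + 2)%num, (P + N.succ (4 * (3 * u + 2) * P / (3 * uu)))%num, (L + N.succ (P / uu))%num)
  else ((u + 2)%num, P, L).

Fixpoint run (fuel : nat) (s : N * N * N) : N * N * N :=
  if fuel is f.+1 then run f (advance s) else s.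

Definition bound : N := (2 ^ 16)%num.

Definition final_test (s : N * N * N) : bool :=
  let: (u, P, L) := s in
  N.eqb u bound &&
  N.ltb (65 * (4 * bound * L + 7 * P))%num (18 * 4 * bound * scale)%num.

(** The fuel is chosen so that [6 + 2 * 32765 = 2 ^ 16]. *)
Lemma final_test_true : final_test (run (N.to_nat 32765) (6%num, scale, 0%num)).
Proof. by vm_compute. Qed.

(** This direction gives soundness: a composite number passing the sieve could only enlarge the
    upper bounds. *)
Lemma sieve_prime l n : all (N.ltb 1) l -> prime (N.to_nat n) -> sieve l n.
Proof.
move=> + pn; elim: l => //= q l IH /andP[/N.ltb_lt q1 hl].
case: N.eqb_spec => [|_]; last exact: IH.
have q0 : q <> 0%num by lia.
move/(N.mod_divide _ _ q0) => [c nE]; apply/N.eqb_eq.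
have /primeP[_ h] := pn.
have dq : (N.to_nat q %| N.to_nat n)%N by rewrite nE N2Nat.inj_mul dvdn_mull.
by case/orP: (h _ dq) => /eqP e; lia.
Qed.

Lemma small_primes_gt1 : all (N.ltb 1) small_primes.
Proof. by vm_compute. Qed.

Lemma boundE : N.to_nat bound = (2 ^ 16)%N.
Proof.
have pow2 k : N.to_nat (2 ^ N.of_nat k)%num = (2 ^ k)%N.
  elim: k => [//|k IH]; rewrite Nat2N.inj_succ N.pow_succ_r'.
  by rewrite N2Nat.inj_mul IH expnS.
exact: (pow2 16).
Qed.

Section Numerics.
Variable R : realFieldType.
Local Notation Growth := (@Growth R).
Local Notation Loss := (@Loss R).
Local Notation growth := (@growth R).

Definition nr (a : N) : R := (N.to_nat a)%:R.

Lemma nrD a b : nr (a + b)%num = nr a + nr b.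
Proof. by rewrite /nr N2Nat.inj_add natrD. Qed.

Lemma nrM a b : nr (a * b)%num = nr a * nr b.
Proof. by rewrite /nr N2Nat.inj_mul natrM. Qed.

Lemma nr_ge0 a : 0 <= nr a.
Proof. exact: ler0n. Qed.

Lemma nr_div a b : 0 < nr b -> nr a / nr b <= nr (N.succ (a / b)).
Proof.
move=> b0; rewrite ler_pdivrMr // mulrC -nrM ler_nat.
have bn : b <> 0%num by move=> e; move: b0; rewrite e /nr ltxx.
have := N.mul_succ_div_gt a b bn; lia.
Qed.

(** [D] stands for [nr scale], kept abstract so that [2 ^ 40] is never unfolded in unary. *)
Definition state_ok (D : R) (s : N * N * N) : Prop :=
  let: (u, P, L) := s in
  [/\ ~~ odd (N.to_nat u), (6 <= N.to_nat u)%N,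
      Growth (N.to_nat u).+1 * D <= nr P & Loss (N.to_nat u).+1 * D <= nr L].

Lemma advance_ok D s : 0 <= D -> state_ok D s -> state_ok D (advance s).
Proof.
move=> D0; case: s => [[u P] L] [ou u6 hP hL]; rewrite /advance.
set n := N.to_nat u in ou u6 hP hL.
have n2 : N.to_nat (u + 2) = n.+2 by rewrite /n; lia.
(* As [u] is even, the number skipped by a step of 2 is even and no prime is missed. *)
have npr : prime n.+2 = false.
  by apply/negP => pr; case/even_prime: pr => [|]; [lia | rewrite /= negbK (negPf ou)].
have G2 : Growth n.+3 = Growth n.+1 * (if prime n.+1 then growth n.+1 else 1).
  by rewrite (@GrowthS _ n.+2) ?npr ?mulr1 ?(@GrowthS _ n.+1) //; lia.
have L2 : Loss n.+3 = Loss n.+1 + (if prime n.+1 then Growth n.+1 / (n.+1%:R - 1) ^+ 2 else 0).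
  by rewrite (@LossS _ n.+2) ?npr ?addr0 ?(@LossS _ n.+1) //; lia.
have e : N.to_nat (N.succ u) = n.+1 by rewrite N2Nat.inj_succ.
have un : nr u = n%:R by [].
have u0 : 6 <= nr u by rewrite un ler_nat.
case: ifP => [_|sv]; last first.
  have np : prime n.+1 = false.
    by apply/negP => pr; move/negP: sv; apply; apply: sieve_prime small_primes_gt1 _; rewrite e.
  by rewrite np in G2 L2; split; rewrite n2 ?G2 ?L2 ?mulr1 ?addr0 //; [rewrite /= negbK | lia].
have uu0 : 0 < nr (u * u) by rewrite nrM mulr_gt0 //; lra.
have uu3 : 0 < nr (3 * (u * u)) by rewrite nrM mulr_gt0 // /nr ltr0n.
have h1 := nr_div (4 * (3 * u + 2) * P) uu3; have h2 := nr_div P uu0.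
have hn1 : n.+1%:R - 1 = nr u :> R by rewrite -natr1 addrK.
have growE : growth n.+1 = 1 + nr (4 * (3 * u + 2)) / nr (3 * (u * u)).
  rewrite /growth hn1 (_ : n.+1%:R = nr u + 1) ?un ?natr1 // -un !nrM nrD nrM.
  rewrite (_ : nr 4 = 4) // (_ : nr 3 = 3) // (_ : nr 2 = 2) //.
  by field; lra.
have g1 : 0 <= nr (4 * (3 * u + 2)) / nr (3 * (u * u)) by rewrite divr_ge0 ?nr_ge0.
have G0 : 0 <= Growth n.+1 by rewrite (le_trans ler01 (Growth_ge1 _ _)).
split; rewrite n2; [by rewrite /= negbK | by lia | |].
  rewrite G2 nrD; apply: le_trans (_ : nr P * (1 + nr (4 * (3 * u + 2)) / nr (3 * (u * u))) <= _).
    case: ifP => _; last by rewrite mulr1; apply: le_trans hP _; rewrite ler_peMr ?nr_ge0 // lerDl.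
    by rewrite growE mulrAC ler_wpM2r // addr_ge0.
  rewrite mulrDr mulr1 lerD2l; apply: le_trans h1.
  by rewrite (nrM _ P) mulrA [nr P * _]mulrC.
rewrite L2 nrD mulrDl; apply: lerD => //; apply: le_trans h2.
case: ifP => _; last by rewrite mul0r divr_ge0 ?nr_ge0.
by rewrite hn1 nrM -expr2 mulrAC ler_wpM2r // invr_ge0 exprn_ge0 ?nr_ge0.
Qed.

Lemma run_ok D fuel s : 0 <= D -> state_ok D s -> state_ok D (run fuel s).
Proof. by move=> D0; elim: fuel s => [//|f IH] s hs; apply/IH/advance_ok. Qed.

Lemma final_test_ok s : state_ok (nr scale) s -> final_test s ->
  Loss (2 ^ 16).+1 + 7 / 4 * Growth (2 ^ 16).+1 / (2 ^ 16)%:R < 18 / 65.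
Proof.
case: s => [[u P] L] [_ _ hP hL] /andP[/N.eqb_eq uE /N.ltb_lt h].
rewrite uE boundE in hP hL.
have {}h : nr (65 * (4 * bound * L + 7 * P)) < nr (18 * 4 * bound * scale) by rewrite ltr_nat; lia.
have b0 : 0 < nr bound by rewrite /nr boundE ltr0n expn_gt0.
have <- : nr bound = (2 ^ 16)%:R by rewrite /nr boundE.
(* Positivity is read off [h], whose right side would vanish for a zero scale. *)
have s0 : 0 < nr scale.
  rewrite lt_neqAle nr_ge0 andbT; apply: contraTneq h => e.
  by rewrite -leNgt [X in X <= _]nrM -e mulr0 nr_ge0.
move: hP hL h; rewrite !nrM nrD !nrM.
rewrite (_ : nr 4 = 4) // (_ : nr 65 = 65) // (_ : nr 7 = 7) // (_ : nr 18 = 18) //.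
move: (Growth _) (Loss _) (nr bound) (nr scale) (nr P) (nr L) s0 b0 => G l b D p q s0 b0.
move=> hP hL h; rewrite -(ltr_pM2r s0) -(ltr_pM2r b0).
have -> : (l + 7 / 4 * G / b) * D * b = (l * D) * b + 7 / 4 * (G * D) by field; apply/eqP; lra.
have := ler_wpM2r (ltW b0) hL; lra.
Qed.

Lemma init_ok c : state_ok (nr c) (6%num, c, 0%num).
Proof.
rewrite /state_ok (_ : N.to_nat 6 = 6%N) // /Growth /Loss !big_geq //.
by rewrite mul0r mul1r nr_ge0.
Qed.

Lemma Loss_lt_bound k : 65 / 27 * Loss k < 2 / 3.
Proof.
have h := final_test_ok (run_ok _ (nr_ge0 scale) (init_ok scale)) final_test_true.
exact: (Loss_bound k (leqnn 16) h).
Qed.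

End Numerics.

(** * Minimal covers *)

Section Minimal.
Variables (I : finType) (r d : I -> nat).
Hypothesis d1 : forall i, (1 < d i)%N.
Hypothesis anti : forall i j, (d i %| d j)%N -> i = j.

Definition covers (A : {set I}) := forall x, exists2 i, i \in A & hit r d i x.

(* Some L is divisible by the other moduli but not by q ^ b, so progression i contains at most one
   of x and x + L, while the other progressions do not distinguish them. *)
Lemma covers_remove A i q b : prime q -> d i = (q ^ b)%N -> covers A -> covers (A :\ i)%SET.
Proof.
move=> pq; case: b => [|b] di cA; first by have := d1 i; rewrite di.
pose L := (q ^ b * (\prod_j d j)`_q^')%N.
have P0 : (0 < \prod_j d j)%N by rewrite prodn_gt0 // => j; apply: ltnW.
have dL j : j != i -> (d j %| L)%N.
  move=> ji; rewrite -(@partnC q (d j)) ?(ltnW (d1 j)) // p_part; apply: dvdn_mul.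
    rewrite dvdn_exp2l // leqNgt; apply: contra ji => h; apply/eqP/esym/anti.
    by rewrite di pfactor_dvdn // ltnW.
  by apply: partn_dvd => //; rewrite (bigD1 j) //= dvdn_mulr.
have iL : ~~ (d i %| L)%N.
  rewrite di pfactor_dvdn ?muln_gt0 ?expn_gt0 ?part_gt0 ?prime_gt0 //.
  rewrite /L lognM ?part_gt0 //; last by rewrite expn_gt0 prime_gt0.
  rewrite lognX logn_prime // eqxx muln1.
  rewrite logn_coprime ?addn0 -?ltnNge //.
  by apply: (@pnat_coprime q); rewrite ?pnat_id ?part_pnat.
move=> x; have [z hz hiz] : exists2 z, ~~ hit r d i z & forall j, j != i -> hit r d j z = hit r d j x.
  case hx : (hit r d i x); last by exists x; rewrite ?hx.
  exists (x + L)%N => [|j ji]; last by rewrite hit_shift ?dL.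
  apply: contra iL => h; move: hx h => /eqP hx /eqP h.
  have := eqn_modDl x L 0 (d i); rewrite addn0 h hx eqxx mod0n => /esym.
  by rewrite -/(dvdn _ _).
have [j jA hj] := cA z; have ji : j != i by apply: contraNneq hz => <-.
by exists j; rewrite ?in_setD1 ?ji // -hiz.
Qed.

(** Induction on the size of [A] replaces the choice of a minimal cover: a progression with prime
    power modulus is discarded while there is one, and then [uncovered] applies to what is left. *)
Lemma not_covers (A : {set I}) : ~ covers A.
Proof.
have [n] := ubnP #|A|; elim: n A => // n IH A; rewrite ltnS => An cA.
case: (boolP [exists i in A, d i == (pdiv (d i) ^ logn (pdiv (d i)) (d i))%N]).
  case/existsP=> i /andP[iA /eqP di]; apply: (IH (A :\ i)%SET).
    by move: An; rewrite (cardsD1 i) iA.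
  by apply: covers_remove di cA; apply: pdiv_prime.
move=> /exists_inPn hA.
pose J := {i : I | i \in A}.
have [||||x hx] := @uncovered rat J (r \o val) (d \o val).
- by move=> i; apply: d1.
- by move=> i j /anti /val_inj.
- move=> i q b pq /= e; have := hA (val i) (valP i); case: b e => [|b] e.
    by have := d1 (val i); rewrite e.
  by rewrite e pdiv_pfactor // pfactorK // eqxx.
- exact: Loss_lt_bound.
have [i iA hi] := cA x; by have := hx (exist _ i iA); rewrite /hit /= in hi *; rewrite hi.
Qed.

End Minimal.

Unset Implicit Arguments.
Local Open Scope classical_set_scope.
Local Open Scope ring_scope.

Theorem theorem1p2 (k : nat) (a : 'I_k -> int) (d : 'I_k -> nat)
    (hd : forall i : 'I_k, (1 < d i)%N)
    (hcov : \bigcup_(i in [set: 'I_k]) arith_prog (a i) (d i) = [set: int]) :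
  exists i j : 'I_k, i <> j /\ (d i %| d j)%N.
Proof.
have [/existsP[i /existsP[j /andP[/eqP ij dij]]]|h] :=
  boolP [exists i, exists j, (i != j) && (d i %| d j)%N].
  by exists i, j.
(* Covering the nonnegative integers already leads to a contradiction, so each progression is
   represented by its least nonnegative residue. *)
pose r i := `|(a i %% d i)%Z|%N.
have anti i j : (d i %| d j)%N -> i = j.
  move=> dij; apply/eqP; move/existsPn/(_ i)/existsPn/(_ j): h.
  by rewrite dij andbT negbK.
have [] := @not_covers _ r d hd anti [set: 'I_k]%SET.
move=> x; have : [set: int] x%:Z by [].
rewrite -hcov => -[i _ [m _ e]]; exists i; first by rewrite inE.
rewrite /hit /r; apply/eqP; have d0 : (d i)%:Z != 0 by have := hd i; lia.
apply/eqP; rewrite -eqz_nat -!modz_nat gez0_abs ?modz_ge0 // modz_mod -e.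
by rewrite addrC mulrC modzMDl.
Qed.
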